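(* Let $0\le a<b\le T$ and $N\ge1$, and fix an ordered binary tree on $\{a,\dots,b\}$. When all the dSMC variables are distributed according to $\pi_{a:b}$ and, conditionally on them, the pair $(I,J)$ is drawn from the multinomial distribution with weights $(W_c^{m,n})_{m,n=1}^N$ (where $c$ is the split point of the root $a:b$), the star trajectory $X^*_{a:b}$ is marginally distributed according to $\mathbb{Q}_{a:b}$.
   Context: $\mathcal{X}$ is the state space (a measurable space), $T\ge1$ an integer, $P_t(\mathrm{d}x_t\mid x_{t-1})$, $t=1,\dots,T$, Markov kernels on $\mathcal{X}$, $h_t:\mathcal{X}\to[0,\infty)$ measurable potentials, and $(\nu_t)_{t=0}^T$ probability measures on $\mathcal{X}$ such that for all $t>0$ and all $x_{t-1}$, $P_t(\cdot\mid x_{t-1})$ is absolutely continuous with respect to $\nu_t$. For $0\le a\le b\le T$, $$\mathbb{Q}_{a:b}(\mathrm{d}x_{a:b})=\frac1{L_{a:b}}\left[\nu_a(\mathrm{d}x_a)\prod_{t=a+1}^bP_t(\mathrm{d}x_t\mid x_{t-1})\right]\prod_{t=a+1}^bh_t(x_t),$$ with $L_{a:b}$ the normalizing constant (assumed positive), empty products equal to $1$, so $\mathbb{Q}_{a:a}=\nu_a$, $L_{a:a}=1$. The weight function is the Radon–Nikodym derivative $\omega_c(x_{c-1},x_c)=\frac{P_c(\mathrm{d}x_c\mid x_{c-1})h_c(x_c)}{\nu_c(\mathrm{d}x_c)}$. Let $(q_t)_{t=0}^T$ be proposal probability measures on $\mathcal{X}$ with $\nu_t$ absolutely continuous with respect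 to $q_t$. Tree: the root is the interval $a:b$; each node $a':b'$ with $a'<b'$ has two children $a':c'-1$ and $c':b'$ for a split point $c'$ with $a'<c'\le b'$; nodes $a':a'$ are leaves. All quantities below are defined recursively along the tree; for a generic internal node write $a:b$ with split point $c$. dSMC (de-Sequentialized Monte Carlo) variables: particles $x_k^{1:N}\in\mathcal{X}^N$ for each time $k$, and resampling index pairs $(l_c^{n},r_c^{n})_{n=1}^N\in(\{1,\dots,N\}^2)^N$ for each split point $c$. The composed resampling indices $\sigma^n_{a:b}(k)\in\{1,\dots,N\}$, $a\le k\le b$, are $\sigma^n_{a:a}(a)=n$ at leaves and $$\sigma^m_{a:b}(k)=\sigma^{l_c^m}_{a:c-1}(k)\ \text{ for } a\le k<c,\qquad \sigma^m_{a:b}(k)=\sigma^{r_c^m}_{c:b}(k)\ \text{ for } c\le k\le b.$$ Each node carries weights $w^{1:N}_{a:b}$: at a leaf, $w^n_{a:a}=\frac{\mathrm{d}\nu_a}{\mathrm{d}q_a}(x_a^n)\big/\sum_{m=1}^N\frac{\mathrm{d}\nu_a}{\mathrm{d}q_a}(x_a^m)$; at any other node $w^n_{a:b}=1/N$. The normalized pair weights at an internal node are $$W_c^{m,n}\propto w^m_{a:c-1}\,w^n_{c:b}\;\omega_c\left(x_{c-1}^{\sigma^m_{a:c-1}(c-1)},x_c^{\sigma^n_{c:b}(c)}\right),\qquad\sum_{m,n=1}^NW_c^{m,n}=1.$$ The law $\psi_{a:b}$ of all variables generated by dSMC is $\psi_{a:a}(\mathrm{d}x_a^{1:N})=\prod_{n=1}^Nq_a(\mathrm{d}x_a^n)$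 at leaves and $$\psi_{a:b}(\mathrm{d}x^{1:N}_{a:b},l^{1:N}_{a+1:b},r^{1:N}_{a+1:b})=\psi_{a:c-1}(\mathrm{d}x^{1:N}_{a:c-1},l^{1:N}_{a+1:c-1},r^{1:N}_{a+1:c-1})\,\psi_{c:b}(\mathrm{d}x^{1:N}_{c:b},l^{1:N}_{c+1:b},r^{1:N}_{c+1:b})\prod_{n=1}^NW_c^{l_c^n,r_c^n}.$$ Its marginal over all variables except $(l_c^{1:N},r_c^{1:N})$ is $\psi_{a:c-1}\times\psi_{c:b}$ and is also denoted $\psi_{a:b}$. The normalizing constant estimate is $L^N_{a:a}=\frac1N\sum_{n=1}^N\frac{\mathrm{d}\nu_a}{\mathrm{d}q_a}(x_a^n)$ at leaves and $$L^N_{a:b}=L^N_{a:c-1}L^N_{c:b}\left\{\sum_{i,j=1}^Nw^i_{a:c-1}\,w^j_{c:b}\;\omega_c\left(x_{c-1}^{\sigma^i_{a:c-1}(c-1)},x_c^{\sigma^j_{c:b}(c)}\right)\right\},$$ which does not depend on $(l_c^{1:N},r_c^{1:N})$ (when both children are internal nodes, the factor in braces is $\frac1{N^2}\sum_{i,j}\omega_c(\cdot,\cdot)$). Define $$\pi_{a:b}(\mathrm{d}x^{1:N}_{a:b},l^{1:N}_{a+1:c-1},l^{1:N}_{c+1:b},r^{1:N}_{a+1:c-1},r^{1:N}_{c+1:b})=\frac{L^N_{a:b}}{L_{a:b}}\,\psi_{a:b}(\mathrm{d}x^{1:N}_{a:b},l^{1:N}_{a+1:c-1},l^{1:N}_{c+1:b},r^{1:N}_{a+1:c-1},r^{1:N}_{c+1:b}).$$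 Star trajectory: given all the variables under $\pi_{a:b}$ and $(I,J)$ drawn from $\{1,\dots,N\}^2$ with probabilities $W_c^{m,n}$, set $\sigma^*_{a:b}(k)=\sigma^I_{a:c-1}(k)$ for $a\le k<c$, $\sigma^*_{a:b}(k)=\sigma^J_{c:b}(k)$ for $c\le k\le b$, and $X^*_{a:b}=(X_k^{\sigma^*_{a:b}(k)})_{k=a}^b$. *)

(* Defs.v *)
From HB Require Import structures.
From mathcomp Require Import all_boot all_order all_algebra.
From mathcomp Require Import all_classical all_reals all_analysis.

Unset Printing Implicit Defensive.

Import Order.TTheory GRing.Theory Num.Theory.
Import numFieldNormedType.Exports.

Local Open Scope classical_set_scope.
Local Open Scope ring_scope.
Local Open Scope ereal_scope.

(* Resampling indices range over 'I_n.+1, seen as a discrete space. *)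
HB.instance Definition _ (n : nat) := isPointed.Build 'I_n.+1 ord0.
HB.instance Definition _ (n : nat) :=
  @isMeasurable.Build default_measure_display 'I_n.+1 discrete_measurable
    discrete_measurable0 discrete_measurableC discrete_measurableU.

(* [f] is a version, finite and nonnegative everywhere, of the Radon-Nikodym
   derivative of [m] with respect to [mu].  The library's ['d m '/d mu] is one
   fixed version and needs [m] to be finite. *)
Definition is_RN_derivative {d} {X : measurableType d} {R : realType}
    (mu m : set X -> \bar R) (f : X -> R) : Prop :=
  [/\ measurable_fun [set: X] f,
      (forall x, (0 <= f x)%R) &
      forall A, measurable A -> m A = \int[mu]_(x in A) (f x)%:E].

(* If all weights vanish the normalization is uniform, so that normalized
   weights always sum to 1.  In dSMC this choice is immaterial: it only concerns
   configurations where the normalizing constant estimate is 0. *)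
Definition normalize {R : realType} {I : finType} (u : I -> R) (i : I) : R :=
  let s := (\sum_j u j)%R in
  if s == 0%R then (#|I|%:R^-1)%R else (u i / s)%R.

(* The law of (Z, I), for Z of law [mu] and I drawn in a finite type with
   probabilities [p Z] conditionally on Z. *)
Definition draw {d} {S : measurableType d} {R : realType} {I : finType}
    (mu : set S -> \bar R) (p : S -> I -> R) : set (S * I) -> \bar R :=
  fun A => \int[mu]_z \sum_(i : I) (p z i)%:E * (\1_A (z, i))%:E.

Section path_measure.
Context {d} {X : measurableType d} {R : realType}.
Variables (P : nat -> R.-pker X ~> X) (h : nat -> X -> R).
Variable nu : nat -> probability X R.

(* Law of (x_(t+1), ..., x_(t+n)) given x_t = x. *)
Fixpoint path_kernel (t n : nat) (x : X) : set (n.-tuple X) -> \bar R :=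
  match n return set (n.-tuple X) -> \bar R with
  | 0 => \d_[tuple]
  | m.+1 => fun A =>
      \int[P t.+1 x]_y path_kernel t.+1 m y [set v : m.-tuple X | A [tuple of y :: v]]
  end.

(* nu_a(dx_a) \prod_(a < t <= b) P_t(dx_t | x_(t-1)). *)
Definition path_law (a b : nat) : set ((b - a).+1.-tuple X) -> \bar R :=
  fun A => \int[nu a]_x
    path_kernel a (b - a) x [set v : (b - a).-tuple X | A [tuple of x :: v]].

(* The i-th entry of a path over a:b is x_(a+i). *)
Definition path_potential {a b : nat} (v : (b - a).+1.-tuple X) : R :=
  \prod_(i < b - a) h (a + i.+1) (tnth v (lift ord0 i)).

Definition normalizing_constant (a b : nat) : \bar R :=
  \int[path_law a b]_v (path_potential v)%:E.

Definition Q (a b : nat) : set ((b - a).+1.-tuple X) -> \bar R :=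
  fun A => ((fine (normalizing_constant a b))^-1)%:E *
           \int[path_law a b]_(v in A) (path_potential v)%:E.

End path_measure.

(* An internal node carries its split point. *)
Inductive split_tree : Type :=
| Leaf
| Node (c : nat) (l r : split_tree).

Fixpoint tree_on (a b : nat) (t : split_tree) : bool :=
  match t with
  | Leaf => a == b
  | Node c l r => [&& (a < c <= b)%N, tree_on a c.-1 l & tree_on c b r]
  end.

Section product_power.
Context {d} {X : measurableType d} {R : realType} (q : set X -> \bar R).

(* q^{\otimes n}. *)
Fixpoint product_power (n : nat) : set (n.-tuple X) -> \bar R :=
  match n return set (n.-tuple X) -> \bar R with
  | 0 => \d_[tuple]
  | m.+1 => pushforward (q \x product_power m)
              (fun p : X * m.-tuple X => [tuple of p.1 :: p.2])
  end.

End product_power.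

(* There are N = M.+1 particles. *)
Section dSMC.
Context {d} {X : measurableType d} {R : realType} (M : nat).
Local Notation N := M.+1.

Fixpoint vars_display (t : split_tree) : measure_display :=
  match t with
  | Leaf => measure_tuple_display d
  | Node _ l r =>
      measure_prod_display
        (measure_prod_display (vars_display l, vars_display r),
         measure_tuple_display (measure_prod_display
           (default_measure_display, default_measure_display)))
  end.

(* All variables generated at a node: x^{1:N} at a leaf; at an internal node,
   those of the two children and (l_c^n, r_c^n)_n. *)
Fixpoint vars (t : split_tree) : measurableType (vars_display t) :=
  match t return measurableType (vars_display t) with
  | Leaf => N.-tuple X
  | Node _ l r => ((vars l * vars r) * N.-tuple ('I_N * 'I_N))%type
  end.

Fixpoint particles {t : split_tree} : vars t -> nat -> N.-tuple X :=
  match t return vars t -> nat -> N.-tuple X with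
  | Leaf => fun x _ => x
  | Node c l r => fun z k =>
      if (k < c)%N then particles z.1.1 k else particles z.1.2 k
  end.

Fixpoint sigma {t : split_tree} : vars t -> 'I_N -> nat -> 'I_N :=
  match t return vars t -> 'I_N -> nat -> 'I_N with
  | Leaf => fun _ n _ => n
  | Node c l r => fun z m k =>
      if (k < c)%N then sigma z.1.1 (tnth z.2 m).1 k
      else sigma z.1.2 (tnth z.2 m).2 k
  end.

Definition resampled {t : split_tree} (z : vars t) (n : 'I_N) (k : nat) : X :=
  tnth (particles z k) (sigma z n k).

(* [q] : proposals, [g t] : d(nu_t)/d(q_t), [omega c (x_(c-1), x_c)] : weights. *)
Variables (q : nat -> probability X R) (g : nat -> X -> R).
Variable omega : nat -> X * X -> R.

(* Below, [a] is the left end of the interval of the node [t]. *)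
Definition node_weight (a : nat) {t : split_tree} : vars t -> 'I_N -> R :=
  match t return vars t -> 'I_N -> R with
  | Leaf => fun x => normalize (fun n => g a (tnth x n))
  | Node _ _ _ => fun _ _ => (N%:R^-1)%R
  end.

Definition pair_weight (a c : nat) {l r : split_tree} (z : vars l * vars r)
    (p : 'I_N * 'I_N) : R :=
  (node_weight a z.1 p.1 * node_weight c z.2 p.2 *
   omega c (resampled z.1 p.1 c.-1, resampled z.2 p.2 c))%R.

Definition W (a c : nat) {l r : split_tree} (z : vars l * vars r) :
    'I_N * 'I_N -> R :=
  normalize (pair_weight a c z).

Fixpoint psi (a : nat) (t : split_tree) : set (vars t) -> \bar R :=
  match t return set (vars t) -> \bar R with
  | Leaf => product_power (q a) N
  | Node c l r =>
      draw (psi a l \x psi c r)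
        (fun z (s : N.-tuple ('I_N * 'I_N)) =>
           (\prod_(n < N) W a c z (tnth s n))%R)
  end.

Fixpoint LN (a : nat) {t : split_tree} : vars t -> R :=
  match t return vars t -> R with
  | Leaf => fun x => (N%:R^-1 * \sum_(n < N) g a (tnth x n))%R
  | Node c l r => fun z =>
      (LN a z.1.1 * LN c z.1.2 *
       \sum_(i < N) \sum_(j < N) pair_weight a c z.1 (i, j))%R
  end.

(* Value of [LN a] at an internal node, which ignores the resampling indices of
   that node. *)
Definition LN_children (a c : nat) {l r : split_tree}
    (z : vars l * vars r) : R :=
  (LN a z.1 * LN c z.2 *
   \sum_(i < N) \sum_(j < N) pair_weight a c z (i, j))%R.

Lemma LN_Node a c l r (z : vars (Node c l r)) : LN a z = LN_children a c z.1.
Proof. by []. Qed.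

Variables (P : nat -> R.-pker X ~> X) (h : nat -> X -> R).
Variable nu : nat -> probability X R.

(* The density is taken with respect to the marginal of psi_{a:b} without the
   resampling indices of the root. *)
Definition pi_law (a b c : nat) (l r : split_tree) :
    set (vars l * vars r) -> \bar R :=
  fun A => \int[psi a l \x psi c r]_(z in A)
    (LN_children a c z / fine (normalizing_constant P h nu a b))%:E.

Definition star_law (a b c : nat) (l r : split_tree) :
    set ((vars l * vars r) * ('I_N * 'I_N)) -> \bar R :=
  draw (pi_law a b c l r) (fun z => W a c z).

Definition sigma_star (c : nat) {l r : split_tree}
    (z : (vars l * vars r) * ('I_N * 'I_N)) (k : nat) : 'I_N :=
  if (k < c)%N then sigma z.1.1 z.2.1 k else sigma z.1.2 z.2.2 k.

Definition star_trajectory (a b c : nat) (l r : split_tree)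
    (z : (vars l * vars r) * ('I_N * 'I_N)) : (b - a).+1.-tuple X :=
  [tuple let k := (a + i)%N in
         tnth (if (k < c)%N then particles z.1.1 k else particles z.1.2 k)
              (sigma_star c z k) | i < (b - a).+1].

End dSMC.

(* Main.v *)
(* Write gamma_{a:b}(F) for the integral of F against the unnormalized law
   L_{a:b} Q_{a:b}.  By induction on the tree, for every nonnegative F,
     E_psi[ L^N_{a:b} sum_n w^n F(trajectory of the n-th particle) ]
       = gamma_{a:b}(F).
   At a leaf this is importance sampling from q_a.  At an internal node, each
   resampled pair has law W_c given the children, and
   L^N_{a:b} W_c^{i,j} = (L^N_{a:c-1} w^i) (L^N_{c:b} w^j) omega_c, so, the children
   being independent, the induction hypothesis can be applied to one and then to
   the other, with the test function omega_c(x_{c-1}, x_c) F; omega_c glues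
   gamma_{a:c-1} and gamma_{c:b} into gamma_{a:b}.  Since the density of pi_{a:b}
   is L^N_{a:b} / L_{a:b}, the star trajectory involves the same expectation as
   an internal node, divided by L_{a:b}. *)

Require Import Defs.
From HB Require Import structures.
From mathcomp Require Import all_boot all_order all_algebra.
From mathcomp Require Import all_classical all_reals all_analysis.
From mathcomp Require Import measurable_realfun ring.

Unset Printing Implicit Defensive.

Import Order.TTheory GRing.Theory Num.Theory.
Import numFieldNormedType.Exports.

Local Open Scope classical_set_scope.
Local Open Scope ring_scope.
Local Open Scope ereal_scope.

(** * Mixtures and densities *)

Section mixture.
Context {d d'} {Z : measurableType d} {Y : measurableType d'} {R : realType}.
Variables (mu : {measure set Z -> \bar R}) (k : Z -> {measure set Y -> \bar R}).

(** The composition of [mu] with the kernel [k]. Keeping [k] a plain family of measures, with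
    measurability assumed separately, covers densities, prepended states and random draws alike,
    without finiteness of [mu]. *)
Definition mixture (A : set Y) : \bar R := \int[mu]_z k z A.

Hypothesis mk : forall A, measurable A -> measurable_fun [set: Z] (fun z => k z A).

Let mixture0 : mixture set0 = 0.
Proof. by rewrite /mixture integral0_eq. Qed.

Let mixture_ge0 A : 0 <= mixture A.
Proof. by rewrite /mixture integral_ge0. Qed.

Let mixture_semi_sigma_additive : semi_sigma_additive mixture.
Proof.
move=> F mF tF _; rewrite [X in _ --> X](_ : _ =
    \int[mu]_z \sum_(0 <= i <oo) k z (F i)); last first.
  apply: eq_integral => z _.
  by apply/esym/cvg_lim => //; exact: measure_sigma_additive.
rewrite integral_nneseries//; last by move=> n; exact: mk.
by apply: is_cvg_nneseries => n _ _; exact: integral_ge0.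
Qed.

HB.instance Definition _ := isMeasure.Build _ _ _ mixture
  mixture0 mixture_ge0 mixture_semi_sigma_additive.

Definition mixture_measure : {measure set Y -> \bar R} := mixture.

Import HBNNSimple.

Let sintegral_mixture (f : {nnsfun Y >-> R}) :
  sintegral mixture f = \int[mu]_z sintegral (k z) f.
Proof.
under eq_integral do rewrite sintegralE.
have mkf r : measurable_fun [set: Z] (fun z => k z (f @^-1` [set r])).
  by apply: mk; exact: measurable_sfunP.
rewrite ge0_integral_fsum//; last 2 first.
  by move=> r; exact: measurable_funeM.
  by move=> r z _; exact: nnsfun_mulemu_ge0.
rewrite sintegralE; apply: eq_fsbigr => r _.
have [r0|r0] := leP 0%R r; first by rewrite ge0_integralZl.
(* A negative value is never attained by [f], so both sides are 0. *)
rewrite preimage_nnfun0// measure0 mule0 integral0_eq// => z _.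
by rewrite measure0 mule0.
Qed.

(** Finite sums settle simple functions ([sintegral_mixture]). Increasing simple approximations and
    monotone convergence, under the mixture, under [mu] and under each [k z], give the general
    case. *)
Lemma ge0_integral_mixture (f : Y -> \bar R) :
  measurable_fun [set: Y] f -> (forall y, 0 <= f y) ->
  \int[mixture]_y f y = \int[mu]_z \int[k z]_y f y.
Proof.
move=> mf f0.
pose g := nnsfun_approx measurableT mf.
pose gE := fun n => EFin \o g n.
have mgE n : measurable_fun [set: Y] (gE n) by exact/measurable_EFinP.
have gE_ge0 n x : 0 <= gE n x by rewrite lee_fin.
have nd_gE x : {homo gE ^~ x : n m / (n <= m)%O >-> n <= m}.
  by move=> *; exact/lefP/nd_nnsfun_approx.
transitivity (limn (fun n => \int[mixture]_x gE n x)).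
  rewrite -monotone_convergence//; apply: eq_integral => t _.
  by apply/esym/cvg_lim => //; exact: cvg_nnsfun_approx.
transitivity (limn (fun n => \int[mu]_z \int[k z]_x gE n x)).
  apply: congr_lim; apply/funext => n.
  rewrite integralT_nnsfun sintegral_mixture; apply: eq_integral => x _.
  by rewrite integralT_nnsfun.
rewrite -[LHS]monotone_convergence//; last 3 first.
  by move=> n; exact: measurable_fun_integral_kernel.
  by move=> n x _; exact: integral_ge0.
  by move=> x _ m n mn; apply: ge0_le_integral => // t _; exact: nd_gE.
apply: eq_integral => z _.
rewrite -monotone_convergence//.
apply: eq_integral => t _.
by apply/cvg_lim => //; exact: cvg_nnsfun_approx.
Qed.

End mixture.

Section density.
Context {d} {Z : measurableType d} {R : realType}.
Implicit Types (mu : {measure set Z -> \bar R}) (h : Z -> R) (f : Z -> \bar R).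

(* The absolute value only provides the nonnegativity required by [mscale]. *)
Definition density_kernel h (z : Z) : {measure set Z -> \bar R} :=
  mscale (NngNum (normr_ge0 (h z))) (dirac z).

Let density_kernelE h z A :
  (0 <= h z)%R -> density_kernel h z A = (h z)%:E * (\1_A z)%:E.
Proof. by move=> h0; rewrite /= /mscale/= ger0_norm// diracE indicE. Qed.

Let measurable_density_kernel h A : measurable_fun setT h ->
  (forall z, (0 <= h z)%R) -> measurable A ->
  measurable_fun setT (fun z => density_kernel h z A).
Proof.
move=> mh h0 mA; under eq_fun do rewrite density_kernelE// -EFinM.
by apply/measurable_EFinP/measurable_funM => //; exact: measurable_indic.
Qed.

(** A density is a mixture of point masses: [h z] times the Dirac mass at [z]. This reduces
    densities to the results on mixtures. *)
Let densityE mu h : (forall z, (0 <= h z)%R) ->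
  (fun A => \int[mu]_(z in A) (h z)%:E) = mixture mu (density_kernel h).
Proof.
move=> h0; apply/funext => A; rewrite /mixture integral_mkcond.
apply: eq_integral => z _.
by rewrite density_kernelE// patchE indicE; case: ifP; rewrite ?mule1 ?mule0.
Qed.

(** Densities appear in the definitions as bare set functions; equality with a bundled measure makes
    measure lemmas applicable after rewriting. The existence lemmas for kernels, [draw] and [psi]
    below have the same purpose. *)
Lemma density_measureP mu h :
  measurable_fun setT h -> (forall z, (0 <= h z)%R) ->
  exists m : {measure set Z -> \bar R}, (fun A => \int[mu]_(z in A) (h z)%:E) = m.
Proof.
move=> mh h0; rewrite densityE//.
by exists (mixture_measure mu _ (fun A => measurable_density_kernel h A mh h0)).
Qed.

Lemma ge0_integral_density mu h f :
  measurable_fun setT h -> (forall z, (0 <= h z)%R) ->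
  measurable_fun setT f -> (forall z, 0 <= f z) ->
  \int[fun A => \int[mu]_(z in A) (h z)%:E]_z f z = \int[mu]_z ((h z)%:E * f z).
Proof.
move=> mh h0 mf f0; rewrite densityE//.
rewrite (ge0_integral_mixture _ _
  (fun A => measurable_density_kernel h A mh h0))//.
apply: eq_integral => z _.
by rewrite ge0_integral_mscale//= integral_dirac// diracT mul1e ger0_norm.
Qed.

(** Serves to trade P_t(dy) h_t(y) for omega_t(x, y) nu_t(dy): equal measures integrate [f] alike,
    and each integral is one against a measure with density. *)
Lemma eq_density_integral mu mu' h h' f :
  measurable_fun setT h -> (forall z, (0 <= h z)%R) ->
  measurable_fun setT h' -> (forall z, (0 <= h' z)%R) ->
  (forall A, measurable A ->
    \int[mu]_(z in A) (h z)%:E = \int[mu']_(z in A) (h' z)%:E) ->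
  measurable_fun setT f -> (forall z, 0 <= f z) ->
  \int[mu]_z ((h z)%:E * f z) = \int[mu']_z ((h' z)%:E * f z).
Proof.
move=> mh h0 mh' h0' E mf f0.
rewrite -ge0_integral_density// -[RHS]ge0_integral_density//.
have [m mE] := density_measureP mu h mh h0.
have [m' mE'] := density_measureP mu' h' mh' h0'.
rewrite mE mE'; apply: eq_measure_integral => A mA _.
by rewrite -mE -mE' E.
Qed.

End density.

Definition pushforward_measure {d d'} {Z : measurableType d}
    {Y : measurableType d'} {R : realType} (m : {measure set Z -> \bar R})
    (f : Z -> Y) (mf : measurable_fun setT f) : {measure set Y -> \bar R} :=
  measure_function_pushforward__canonical__measure_function_Measure m mf.

Section measure_probability.
Context {d} {Z : measurableType d} {R : realType} (m : {measure set Z -> \bar R}).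
Hypothesis m1 : m setT = 1.

(** A fresh name for [m], to which the probability structure can be attached. *)
Let mcopy (A : set Z) : \bar R := m A.

HB.instance Definition _ := isMeasure.Build _ _ _ mcopy
  (measure0 m) (measure_ge0 m) (@measure_semi_sigma_additive _ _ _ m).
HB.instance Definition _ := Measure_isProbability.Build _ _ _ mcopy m1.

Lemma measure_probabilityP : exists P : probability Z R, (m : set Z -> \bar R) = P.
Proof. by exists mcopy. Qed.

End measure_probability.

(** * Paths of the Markov chain *)

Lemma measurable_cons_tuple {d} {X : measurableType d} n :
  measurable_fun [set: X * n.-tuple X]
    (fun p : X * n.-tuple X => [tuple of p.1 :: p.2]).
Proof. exact: measurable_cons. Qed.

Lemma measurable_cons_fix {d} {X : measurableType d} n (x : X) :
  measurable_fun [set: n.-tuple X] (fun v : n.-tuple X => [tuple of x :: v]).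
Proof. exact: measurable_cons. Qed.

Section path_kernel.
Context {d} {X : measurableType d} {R : realType}.

Section cons_kernel.
Variables (n : nat) (k : R.-pker X ~> n.-tuple X).

Definition cons_kernel (y : X) : {measure set (n.+1.-tuple X) -> \bar R} :=
  pushforward_measure (k y) _ (measurable_cons_fix n y).

Lemma measurable_cons_kernel A :
  measurable A -> measurable_fun setT (fun y => cons_kernel y A).
Proof.
move=> mA; pose A' := (fun p : X * n.-tuple X => [tuple of p.1 :: p.2]) @^-1` A.
have mA' : measurable A' by rewrite -[A']setTI; exact: measurable_cons_tuple.
(* The value at [y] is the mass under [k y] of the section at [y] of the measurable set of pairs
   [A']. *)
rewrite (_ : (fun y => _) = fun y => k y (xsection A' y)).
  by apply: measurable_fun_xsection_finite_kernel; rewrite inE.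
by apply/funext => y; congr (k y _); apply/seteqP; split=> v;
  rewrite /xsection/= inE.
Qed.

Lemma ge0_integral_cons (m : {measure set X -> \bar R})
    (f : n.+1.-tuple X -> \bar R) :
  measurable_fun setT f -> (forall v, 0 <= f v) ->
  \int[fun A => \int[m]_y k y [set v : n.-tuple X | A [tuple of y :: v]]]_v f v =
  \int[m]_y \int[k y]_v f [tuple of y :: (v : n.-tuple X)].
Proof.
move=> mf f0.
rewrite (ge0_integral_mixture m _ measurable_cons_kernel)//.
apply: eq_integral => y _.
by rewrite ge0_integral_pushforward//; exact: measurable_cons_fix.
Qed.

Lemma kernel_consP (l : R.-pker X ~> X) : exists k' : R.-pker X ~> n.+1.-tuple X,
  forall x, (fun A : set (n.+1.-tuple X) =>
    \int[l x]_y k y [set v : n.-tuple X | A [tuple of y :: v]]) = k' x.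
Proof.
pose k0 x := mixture_measure (l x) cons_kernel measurable_cons_kernel.
have mk0 A : measurable A -> measurable_fun setT (fun y => k0 y A).
  move=> mA.
  apply: (@measurable_fun_integral_kernel _ _ _ _ _ l _ (cons_kernel ^~ A)) => //.
  - by move=> U mU; exact: measurable_kernel.
  - exact: measurable_cons_kernel.
pose i1 := isKernel.Build _ _ _ _ R k0 mk0.
pose k1 : R.-ker X ~> n.+1.-tuple X := HB.pack k0 i1.
have k1T x : k1 x setT = 1.
  rewrite /= /mixture (eq_integral (cst 1)) ?integral_cst//= ?prob_kernel ?mule1//.
  by move=> y _; rewrite /pushforward/= preimage_setT prob_kernel.
pose i2 := Kernel_isProbability.Build _ _ _ _ R k1 k1T.
pose k2 : R.-pker X ~> n.+1.-tuple X := HB.pack k0 i1 i2.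
by exists k2.
Qed.

End cons_kernel.

(** Induction for all [t] at once, since the recursion moves to [t.+1]. The base case is the Dirac
    kernel at the empty tuple; [kernel_consP] prepends one transition. *)
Lemma path_kernelP (P : nat -> R.-pker X ~> X) n t :
  exists k : R.-pker X ~> n.-tuple X, path_kernel P t n = (fun x => k x).
Proof.
elim: n t => [|n ih] t.
  by exists (kdirac (@measurable_cst _ _ X (0.-tuple X) setT [tuple])).
have [k kE] := ih t.+1; have [k' k'E] := kernel_consP n k (P t.+1).
by exists k'; apply/funext => x; rewrite -k'E /= kE.
Qed.

Lemma path_law_measureP (P : nat -> R.-pker X ~> X) (nu : nat -> probability X R) a b :
  exists m : {measure set ((b - a).+1.-tuple X) -> \bar R}, path_law P nu a b = m.
Proof.
have [k kE] := path_kernelP P (b - a) a.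
exists (mixture_measure (nu a) _ (measurable_cons_kernel _ k)).
by rewrite /path_law kE.
Qed.

End path_kernel.

(** * Iterated integrals along a path and their splitting at a time *)

Section path_integral.
Context {d} {X : measurableType d} {R : realType}.

(* Test functions on paths take sequences of any length, so that splitting an
   interval a:b at c needs no cast between tuple types.  The parameter Z keeps
   track of the variables that have not been integrated yet. *)
Definition seq_measurable {dZ} {Z : measurableType dZ} (F : Z -> seq X -> \bar R) :=
  forall n, measurable_fun [set: Z * n.-tuple X] (fun p => F p.1 p.2).

Lemma seq_measurable_section {dZ} {Z : measurableType dZ} (F : Z -> seq X -> \bar R)
    n z : seq_measurable F -> measurable_fun [set: n.-tuple X] (fun v => F z v).
Proof. by move=> mF; exact: measurableT_comp (mF n) (pair1_measurable z). Qed.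

Lemma seq_measurable_comp {d1 d2} {Z1 : measurableType d1} {Z2 : measurableType d2}
    (F : Z2 -> seq X -> \bar R) (g : Z1 -> Z2) :
  seq_measurable F -> measurable_fun setT g -> seq_measurable (F \o g).
Proof.
move=> mF mg n; apply: (measurableT_comp (mF n)
  (g := fun p : Z1 * n.-tuple X => (g p.1, p.2))).
by apply: measurable_fun_pair => //; exact: measurableT_comp.
Qed.

Lemma measurable_cat_tuple m n :
  measurable_fun [set: m.-tuple X * n.-tuple X]
    (fun p : m.-tuple X * n.-tuple X => [tuple of p.1 ++ p.2]).
Proof.
apply/measurable_fun_tnthP => i.
rewrite -[i]fintype.splitK; case: (fintype.split i) => j /=.
  rewrite (_ : _ \o _ = fun p : m.-tuple X * n.-tuple X => tnth p.1 j).
    by apply: (measurableT_comp (measurable_tnth j)).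
  by apply/funext => p /=; exact: tnth_lshift.
rewrite (_ : _ \o _ = fun p : m.-tuple X * n.-tuple X => tnth p.2 j).
  by apply: (measurableT_comp (measurable_tnth j)).
by apply/funext => p /=; exact: tnth_rshift.
Qed.

(** The part of the path already read joins the parameter, leaving a test function of the remaining
    entries. *)
Lemma seq_measurable_cat {dZ} {Z : measurableType dZ} (F : Z -> seq X -> \bar R) m :
  seq_measurable F ->
  seq_measurable (fun (p : Z * m.-tuple X) s => F p.1 (p.2 ++ s)).
Proof.
move=> mF n; apply: (measurableT_comp (mF (m + n)%N)
  (g := fun p : (Z * m.-tuple X) * n.-tuple X =>
          (p.1.1, [tuple of p.1.2 ++ p.2]) : Z * (m + n).-tuple X)).
apply: measurable_fun_pair; first exact: measurableT_comp.
apply: (measurableT_comp (measurable_cat_tuple m n)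
  (g := fun p : (Z * m.-tuple X) * n.-tuple X => (p.1.2, p.2))).
by apply: measurable_fun_pair => //; exact: measurableT_comp.
Qed.

Lemma measurable_head x0 n : measurable_fun setT (fun v : n.-tuple X => head x0 v).
Proof.
case: n => [|n].
  rewrite (_ : (fun _ => _) = cst x0); first exact: measurable_cst.
  by apply/funext => v; rewrite tuple0.
rewrite (_ : (fun _ => _) = fun v => tnth v ord0); first exact: measurable_tnth.
by apply/funext => v; rewrite (tnth_nth x0) nth0.
Qed.

Lemma measurable_last x0 n : measurable_fun setT (fun v : n.-tuple X => last x0 v).
Proof.
case: n => [|n].
  rewrite (_ : (fun _ => _) = cst x0); first exact: measurable_cst.
  by apply/funext => v; rewrite tuple0.
rewrite (_ : (fun _ => _) = fun v => tnth v ord_max); first exact: measurable_tnth.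
by apply/funext => v; rewrite (tnth_nth x0) -(nth_last x0) size_tuple.
Qed.

Lemma seq_measurable_cons {dZ} {Z : measurableType dZ} (F : Z -> seq X -> \bar R) :
  seq_measurable F ->
  seq_measurable (fun (p : Z * X) s => F p.1 (p.2 :: s)).
Proof.
move=> mF m; apply: (measurableT_comp (mF m.+1)
  (g := fun p : (Z * X) * m.-tuple X =>
          (p.1.1, [tuple of p.1.2 :: p.2]) : Z * m.+1.-tuple X)).
apply: measurable_fun_pair; first exact: measurableT_comp.
by apply: measurable_cons => //; exact: measurableT_comp.
Qed.

Variables (nu : nat -> probability X R) (omega : nat -> X * X -> R).

(* The integral of F over (x_(t+1), ..., x_(t+n)) given x_t = x against the kernels
   P_s h_s, written with respect to the measures nu_s through their densities
   omega_s. *)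
Fixpoint path_integral (t n : nat) (x : X) (F : seq X -> \bar R) : \bar R :=
  match n with
  | 0 => F [::]
  | m.+1 => \int[nu t.+1]_y ((omega t.+1 (x, y))%:E *
              path_integral t.+1 m y (fun s => F (y :: s)))
  end.

Variable T : nat.
Hypothesis momega : forall t, (0 < t <= T)%N -> measurable_fun setT (omega t).
Hypothesis omega0 : forall t p, (0 < t <= T)%N -> (0 <= omega t p)%R.

Lemma path_integral_ge0 n t x F : (t + n <= T)%N -> (forall s, 0 <= F s) ->
  0 <= path_integral t n x F.
Proof.
elim: n t x F => [|n ih] t x F tnT F0 /=; first exact: F0.
apply: integral_ge0 => y _; apply: mule_ge0.
  by rewrite lee_fin omega0//=; apply: leq_trans tnT; rewrite addnS ltnS leq_addr.
by apply: ih => //; rewrite addSnnS.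
Qed.

(** Each integration preserves joint measurability by Tonelli. The state just reached moves into the
    parameter, which is why the induction ranges over all [Z]. *)
Lemma measurable_path_integral n t {dZ} {Z : measurableType dZ}
    (F : Z -> seq X -> \bar R) :
  (t + n <= T)%N -> seq_measurable F -> (forall z s, 0 <= F z s) ->
  measurable_fun [set: Z * X] (fun p => path_integral t n p.2 (F p.1)).
Proof.
elim: n t dZ Z F => [|n ih] t dZ Z F tnT mF F0.
  apply: (measurableT_comp (mF 0%N)
    (g := fun p : Z * X => (p.1, [tuple]) : Z * 0.-tuple X)).
  exact: measurable_fun_pair.
have tT : (t.+1 <= T)%N by apply: leq_trans tnT; rewrite addnS ltnS leq_addr.
have tnT' : (t.+1 + n <= T)%N by rewrite addSnnS.
rewrite /=; apply: (@measurable_fun_fubini_tonelli_F _ _ _ _ _ (nu t.+1)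
  (fun q : (Z * X) * X => (omega t.+1 (q.1.2, q.2))%:E *
           path_integral t.+1 n q.2 (fun s => F q.1.1 (q.2 :: s)))) => [|q].
  apply: emeasurable_funM.
    apply/measurable_EFinP/(measurableT_comp (momega t.+1 tT)).
    by apply: measurable_fun_pair => //; exact: measurableT_comp.
  have mF' := seq_measurable_cons F mF.
  apply: (measurableT_comp (ih t.+1 _ _ _ tnT' mF' _)
     (g := fun q : (Z * X) * X => ((q.1.1, q.2), q.2))) => //.
  apply: measurable_fun_pair => //; apply: measurable_fun_pair => //.
  exact: measurableT_comp.
by rewrite mule_ge0// ?lee_fin ?omega0// path_integral_ge0.
Qed.

(** Markov property: the right part sees the left one only through its last state, which is [x]
    itself when [m] is 0, whence [last x u]. *)
Lemma path_integral_cat m n t x F :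
  path_integral t (m + n.+1) x F =
  path_integral t m x (fun u => \int[nu (t + m).+1]_y
    ((omega (t + m).+1 (last x u, y))%:E *
     path_integral (t + m).+1 n y (fun v => F (u ++ y :: v)))).
Proof.
elim: m t x F => [|m ih] t x F; first by rewrite add0n addn0.
rewrite addSn /=; apply: eq_integral => y _; congr (_ * _).
by rewrite ih; rewrite addSnnS.
Qed.

(** Needed to move the factor [omega c] at a cut across the integral over the right segment.
    Nonnegative constants pass through the integrals one at a time. *)
Lemma path_integralZ n t {dZ} {Z : measurableType dZ}
    (F : Z -> seq X -> \bar R) z x (k : R) :
  (t + n <= T)%N -> seq_measurable F -> (forall z s, 0 <= F z s) -> (0 <= k)%R ->
  path_integral t n x (fun s => k%:E * F z s) = k%:E * path_integral t n x (F z).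
Proof.
move=> + mF F0 k0; elim: n t dZ Z F mF F0 z x => [//|n ih] t dZ Z F mF F0 z x tnT.
have tT : (t.+1 <= T)%N by apply: leq_trans tnT; rewrite addnS ltnS leq_addr.
have tnT' : (t.+1 + n <= T)%N by rewrite addSnnS.
have mF' := seq_measurable_cons F mF.
rewrite /= -ge0_integralZl//; last 2 first.
- apply: emeasurable_funM.
    apply/measurable_EFinP/(measurableT_comp (momega t.+1 tT)).
    exact: pair1_measurable.
  apply: (measurableT_comp (measurable_path_integral n t.+1 _ tnT' mF' _)
    (g := fun y => ((z, y), y))) => //.
  by apply: measurable_fun_pair => //; exact: pair1_measurable.
- by move=> y _; rewrite mule_ge0// ?lee_fin ?omega0// path_integral_ge0.
apply: eq_integral => y _.
by rewrite (ih t.+1 _ _ _ mF' _ (z, y))// muleCA.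
Qed.

(** This is gamma_{a:b}(F), expressed through the densities [omega]; [integral_path_law] relates it
    to [path_law] and the potentials. *)
Definition path_law_integral (a b : nat) (F : seq X -> \bar R) : \bar R :=
  \int[nu a]_x path_integral a (b - a) x (fun s => F (x :: s)).

Lemma path_law_integral_ge0 a b F : (a <= b <= T)%N -> (forall s, 0 <= F s) ->
  0 <= path_law_integral a b F.
Proof.
move=> /andP[ab bT] F0; apply: integral_ge0 => x _.
by apply: path_integral_ge0; rewrite ?subnKC.
Qed.

Lemma measurable_path_law_integral a b {dZ} {Z : measurableType dZ}
    (F : Z -> seq X -> \bar R) :
  (a <= b <= T)%N -> seq_measurable F -> (forall z s, 0 <= F z s) ->
  measurable_fun [set: Z] (fun z => path_law_integral a b (F z)).
Proof.
move=> /andP[ab bT] mF F0.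
have abT : (a + (b - a) <= T)%N by rewrite subnKC.
apply: (@measurable_fun_fubini_tonelli_F _ _ _ _ _ (nu a)
  (fun p : Z * X => path_integral a (b - a) p.2 (fun s => F p.1 (p.2 :: s)))).
  apply: (measurableT_comp
    (measurable_path_integral _ _ _ abT (seq_measurable_cons _ mF) _)
    (g := fun p : Z * X => (p, p.2))) => //.
  exact: measurable_fun_pair.
by move=> p; exact: path_integral_ge0.
Qed.

(** The step from c-1 to c integrates omega_c against nu_c, and nu_c is also the initial law of
    gamma_{c:b}. Both segments are nonempty, so [last] and [head] return actual states. *)
Lemma path_law_integral_cat a b c {dZ} {Z : measurableType dZ}
    (F : Z -> seq X -> \bar R) z x0 :
  (a < c <= b)%N -> (b <= T)%N -> seq_measurable F -> (forall z s, 0 <= F z s) ->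
  path_law_integral a b (F z) =
  path_law_integral a c.-1 (fun u => path_law_integral c b (fun v =>
    (omega c (last x0 u, head x0 v))%:E * F z (u ++ v))).
Proof.
move=> /andP[ac cb] bT mF F0; case: c ac cb => // c ac cb.
rewrite ltnS in ac; rewrite /path_law_integral/=.
(* Here [c] has become the time just before the cut: [c - a] steps on its left, one step across,
   then [b - c.+1] steps. *)
have -> : (b - a = (c - a) + (b - c.+1).+1)%N.
  by rewrite -subSn// subSS addnC addnBA// subnK// ltnW.
apply: eq_integral => x _; rewrite path_integral_cat subnKC//.
congr (path_integral _ _ _ _); apply/funext => u.
apply: eq_integral => y _ /=.
(* The prefix up to the first state [y] of the right segment is frozen as a tuple parameter. *)
have mF' := seq_measurable_cat F (size (x :: rcons u y)) mF.
have E v : x :: u ++ y :: v = (x :: rcons u y) ++ v by rewrite /= -cats1 -catA.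
under eq_fun do rewrite E.
under [X in _ = path_integral _ _ _ X]eq_fun do rewrite E.
rewrite (path_integralZ _ _ _ (z, in_tuple (x :: rcons u y)) _ _ _ mF')//.
- by rewrite subnKC.
- by apply: omega0; rewrite /= (leq_trans cb).
Qed.

Lemma seq_measurable_omegaM c {dZ} {Z : measurableType dZ}
    (F : Z -> seq X -> \bar R) x0 m : (0 < c <= T)%N -> seq_measurable F ->
  seq_measurable (fun (p : Z * m.-tuple X) v =>
    (omega c (last x0 p.2, head x0 v))%:E * F p.1 (p.2 ++ v)).
Proof.
move=> cT mF n; apply: emeasurable_funM; last exact: seq_measurable_cat.
apply/measurable_EFinP/(measurableT_comp (momega _ cT)).
apply: measurable_fun_pair.
  apply: (measurableT_comp (measurable_last x0 m)
    (g := fun p : (Z * m.-tuple X) * n.-tuple X => p.1.2)).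
  exact: measurableT_comp.
exact: (measurableT_comp (measurable_head x0 n)).
Qed.

Lemma seq_measurable_path_law_integral b c {dZ} {Z : measurableType dZ}
    (F : Z -> seq X -> \bar R) x0 :
  (0 < c <= b)%N -> (b <= T)%N -> seq_measurable F -> (forall z s, 0 <= F z s) ->
  seq_measurable (fun z u => path_law_integral c b (fun v =>
    (omega c (last x0 u, head x0 v))%:E * F z (u ++ v))).
Proof.
move=> /andP[c0 cb] bT mF F0 m.
have cT : (0 < c <= T)%N by rewrite c0 (leq_trans cb).
apply: (measurable_path_law_integral c b
  (fun (p : Z * m.-tuple X) v =>
    (omega c (last x0 p.2, head x0 v))%:E * F p.1 (p.2 ++ v))).
- by rewrite cb.
- exact: seq_measurable_omegaM.
- by move=> p s; rewrite mule_ge0// lee_fin omega0.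
Qed.

Variables (P : nat -> R.-pker X ~> X) (h : nat -> X -> R).
Hypothesis mh : forall t, (0 < t <= T)%N -> measurable_fun setT (h t).
Hypothesis h0 : forall t x, (0 < t <= T)%N -> (0 <= h t x)%R.
Hypothesis omegaE : forall t x A, (0 < t <= T)%N -> measurable A ->
  \int[P t x]_(y in A) (h t y)%:E = \int[nu t]_(y in A) (omega t (x, y))%:E.

(** The entries of [v] are x_(t+1), ..., x_(t+n); unlike [path_potential], no initial state is
    stored, so the recursion can peel off the first factor. *)
Let potential t n (v : n.-tuple X) : R := (\prod_(i < n) h (t + i.+1) (tnth v i))%R.

Let potential_cons t n y (v : n.-tuple X) :
  potential t n.+1 [tuple of y :: v] = (h t.+1 y * potential t.+1 n v)%R.
Proof.
rewrite /potential big_ord_recl/= addn1; congr (_ * _)%R.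
by apply: eq_bigr => i _; rewrite tnthS/= /bump/= add1n addnS addSn.
Qed.

Let potential_ge0 t n v : (t + n <= T)%N -> (0 <= potential t n v)%R.
Proof.
move=> tnT; apply: prodr_ge0 => i _; apply: h0; rewrite addnS/=.
by apply: leq_trans tnT; rewrite -addnS leq_add2l.
Qed.

Let measurable_potential t n : (t + n <= T)%N -> measurable_fun setT (potential t n).
Proof.
move=> tnT; apply: measurable_prod => i _.
apply: measurableT_comp (measurable_tnth i); apply: mh; rewrite addnS/=.
by apply: leq_trans tnT; rewrite -addnS leq_add2l.
Qed.

Let measurable_potentialM t n (F : seq X -> \bar R) : (t + n <= T)%N ->
  measurable_fun setT (fun v : n.-tuple X => F v) ->
  measurable_fun setT (fun v : n.-tuple X => (potential t n v)%:E * F v).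
Proof.
move=> tnT mF; apply: emeasurable_funM => //.
by apply/measurable_EFinP; exact: measurable_potential.
Qed.

(** Change of measure one step at a time: the first factor [h t.+1] combines with [P t.+1] into
    [omega t.+1] and [nu t.+1], and the induction hypothesis treats the rest with the new state in
    the parameter. *)
Lemma integral_path_kernel n t {dZ} {Z : measurableType dZ}
    (F : Z -> seq X -> \bar R) z x :
  (t + n <= T)%N -> seq_measurable F -> (forall z s, 0 <= F z s) ->
  \int[path_kernel P t n x]_v ((\prod_(i < n) h (t + i.+1) (tnth v i))%:E * F z v)
  = path_integral t n x (F z).
Proof.
rewrite -/(potential _ _ _).
elim: n t dZ Z F z x => [|n ih] t dZ Z F z x tnT mF F0.
  rewrite /= integral_dirac ?diracT ?mul1e ?big_ord0 ?mul1e//.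
  by apply: (measurable_potentialM t 0) => //; exact: seq_measurable_section.
have tT : (t.+1 <= T)%N by apply: leq_trans tnT; rewrite addnS ltnS leq_addr.
have tnT' : (t.+1 + n <= T)%N by rewrite addSnnS.
have mF' := seq_measurable_cons F mF.
have [k kE] := path_kernelP P n t.+1.
rewrite /= kE ge0_integral_cons; last 2 first.
- by apply: measurable_potentialM => //; exact: seq_measurable_section.
- by move=> v; rewrite mule_ge0// lee_fin potential_ge0.
(* The right-hand side is brought back to the kernel [P t.+1 x] with density [h t.+1]. *)
rewrite -(eq_density_integral (P t.+1 x) (nu t.+1) (h t.+1)
  (fun y => omega t.+1 (x, y))
  (fun y => path_integral t.+1 n y (fun s => F z (y :: s)))).
- apply: eq_integral => y _; rewrite -(ih t.+1 _ _ _ (z, y) y tnT' mF')//= kE.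
  rewrite -ge0_integralZl//; last 3 first.
  + apply: (measurable_potentialM _ _ (fun s => F z (y :: s))) => //.
    exact: (seq_measurable_section _ _ (z, y) mF').
  + by move=> v _; rewrite mule_ge0// lee_fin potential_ge0.
  + by rewrite lee_fin h0.
  apply: eq_integral => v _.
  by rewrite -/(potential _ _ _) potential_cons EFinM muleA.
- exact: mh.
- by move=> y; exact: h0.
- exact/(measurableT_comp (momega t.+1 tT))/pair1_measurable.
- by move=> y; exact: omega0.
- by move=> A mA; exact: omegaE.
- apply: (measurableT_comp (measurable_path_integral n t.+1 _ tnT' mF' _)
    (g := fun y => ((z, y), y))) => //.
  by apply: measurable_fun_pair => //; exact: pair1_measurable.
- by move=> y; rewrite path_integral_ge0.
Qed.

Lemma integral_path_law a b {dZ} {Z : measurableType dZ}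
    (F : Z -> seq X -> \bar R) z :
  (a <= b <= T)%N -> seq_measurable F -> (forall z s, 0 <= F z s) ->
  \int[path_law P nu a b]_v ((path_potential (a := a) (b := b) h v)%:E * F z v)
  = path_law_integral a b (F z).
Proof.
move=> /andP[ab bT] mF F0.
have abT : (a + (b - a) <= T)%N by rewrite subnKC.
have pE x (v : (b - a).-tuple X) :
    path_potential (a := a) (b := b) h [tuple of x :: v] = potential a _ v.
  by apply: eq_bigr => i _; rewrite tnthS.
have [k kE] := path_kernelP P (b - a) a.
rewrite /path_law kE ge0_integral_cons; last 2 first.
- apply: emeasurable_funM; last exact: seq_measurable_section.
  apply/measurable_EFinP/measurable_prod => i _.
  apply: (measurableT_comp _ (measurable_tnth (lift ord0 i))); apply: mh.
  by rewrite addnS/= (leq_trans _ abT)// -addnS leq_add2l.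
- move=> v; rewrite mule_ge0// lee_fin; apply: prodr_ge0 => i _; apply: h0.
  by rewrite addnS/= (leq_trans _ abT)// -addnS leq_add2l.
apply: eq_integral => x _.
rewrite -(integral_path_kernel _ _ _ (z, x) x abT (seq_measurable_cons _ mF))//=.
by rewrite kE; apply: eq_integral => v _; rewrite pE.
Qed.

End path_integral.

(** * Resampling *)

(** The preimage splits along the finitely many values of [g]. This handles particles selected by
    random indices. *)
Lemma measurable_fun_finite_choice {d d'} {Z : measurableType d}
    {Y : measurableType d'} {I : finType} (f : Z -> I -> Y) (g : Z -> I) :
  (forall i, measurable_fun setT (f ^~ i)) ->
  (forall i, measurable (g @^-1` [set i])) ->
  measurable_fun setT (fun z => f z (g z)).
Proof.
move=> mf mg _ U mU; rewrite setTI.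
rewrite (_ : _ @^-1` U =
    \bigcup_(i in [set: I]) (g @^-1` [set i] `&` (f ^~ i) @^-1` U)).
  apply: fin_bigcup_measurable => // i _; apply: measurableI => //.
  by rewrite -[X in measurable X]setTI; exact: mf.
apply/seteqP; split=> [z Uz|z [i _ [/= <-]]//].
by exists (g z).
Qed.

Section normalize.
Context {R : realType} {I : finType}.

Lemma normalize_ge0 (u : I -> R) i :
  (forall j, 0 <= u j)%R -> (0 <= normalize u i)%R.
Proof.
move=> u0; rewrite /normalize; case: ifP => _; first by rewrite invr_ge0.
by rewrite divr_ge0// sumr_ge0.
Qed.

Lemma sum_normalize (u : I -> R) : (0 < #|I|)%N -> (\sum_i normalize u i = 1)%R.
Proof.
move=> I0; rewrite /normalize; have [_|s0] := eqVneq (\sum_j u j)%R 0%R.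
  by rewrite sumr_const -[LHS]mulr_natr mulVf// pnatr_eq0 -lt0n.
by rewrite -mulr_suml mulfV.
Qed.

(** Holds even for the uniform default: nonnegative weights of sum 0 all vanish. Every later use of
    normalized weights goes through this product form, so a zero estimate needs no separate case. *)
Lemma normalizeM (u : I -> R) i : (forall j, 0 <= u j)%R ->
  ((\sum_j u j) * normalize u i = u i)%R.
Proof.
move=> u0; rewrite /normalize; have [s0|s0] := eqVneq (\sum_j u j)%R 0%R.
  rewrite s0 mul0r; apply/esym.
  move/eqP: s0; rewrite psumr_eq0// => /allP/(_ i).
  by rewrite mem_index_enum => /(_ isT)/eqP.
by rewrite mulrC divfK.
Qed.

Lemma measurable_normalize {d} {Z : measurableType d} (u : Z -> I -> R) i :
  (forall z j, 0 <= u z j)%R -> (forall j, measurable_fun setT (u ^~ j)) ->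
  measurable_fun setT (fun z => normalize (u z) i).
Proof.
move=> u0 mu; rewrite /normalize.
have ms : measurable_fun setT (fun z => \sum_j u z j)%R by exact: measurable_sum.
apply: measurable_fun_ifT => //.
  by apply: measurable_fun_eqr => //; exact: measurable_cst.
apply: measurable_funM => //.
(* On nonnegative reals, 0 included, the inverse is the power -1, a measurable function. *)
rewrite (_ : (fun z => _^-1)%R = (fun z => (\sum_j u z j) `^ (-1))%R).
  exact: measurableT_comp (measurable_powR _) ms.
by apply/funext => z; rewrite powR_inv1// sumr_ge0.
Qed.

End normalize.

Lemma integral_prob_cst {d} {Z : measurableType d} {R : realType}
    (P : probability Z R) (C : \bar R) : \int[P]_z C = C.
Proof. by rewrite integral_cst// (@probability_setT _ _ _ P) mule1. Qed.

(** * Laws of the particles and of random draws *)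

Section product_power.
Context {d} {X : measurableType d} {R : realType} (q : probability X R).

(** Only one-coordinate marginals matter, because the estimate at a leaf is a sum of functions of
    single particles. Tonelli isolates the first coordinate; the remaining factor integrates a
    constant over a probability. *)
Lemma product_powerP n : exists m : probability (n.-tuple X) R,
  product_power q n = m /\
  forall (f : X -> \bar R) i, measurable_fun setT f -> (forall x, 0 <= f x) ->
    \int[m]_v f (tnth v i) = \int[q]_x f x.
Proof.
elim: n => [|n [m [mE mI]]].
  by exists \d_[tuple]; split=> // f [].
pose m0 := pushforward_measure (q \x m) _ (measurable_cons_tuple n).
have m01 : m0 setT = 1.
  by rewrite /= /pushforward/= preimage_setT; exact: probability_setT.
have [m1 m1E] := measure_probabilityP m0 m01.
exists m1; rewrite -m1E; split=> [|f i mf f0]; first by rewrite /= mE.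
have mft j : measurable_fun setT (fun v : n.+1.-tuple X => f (tnth v j)).
  exact: measurableT_comp (measurable_tnth _).
rewrite ge0_integral_pushforward//; last exact: measurable_cons_tuple.
rewrite preimage_setT (fubini_tonelli1 (m1 := q) (m2 := m)); last 2 first.
- exact: measurableT_comp (mft i) (measurable_cons_tuple n).
- by move=> x; exact: f0.
rewrite /fubini_F/=; case: (unliftP ord0 i) => [j|] -> /=.
  under eq_integral do under eq_integral do rewrite tnthS.
  under eq_integral do rewrite mI//.
  exact: (integral_prob_cst q).
apply: eq_integral => x _; under eq_integral do rewrite tnth0.
exact: (integral_prob_cst m).
Qed.

End product_power.

Section draw.
Context {d} {S : measurableType d} {R : realType} (M : nat).
Local Notation I := (M.+1.-tuple ('I_M.+1 * 'I_M.+1)).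
Variables (mu : probability S R) (p : S -> I -> R).
Hypothesis p0 : forall z i, (0 <= p z i)%R.
Hypothesis mp : forall i, measurable_fun setT (p ^~ i).
Hypothesis p1 : forall z, (\sum_i p z i = 1)%R.

(** Enumerates the index type, as [msum] sums over an initial segment of the naturals. *)
Let nthI (j : nat) : I := nth [tuple (ord0, ord0) | _ < M.+1] (enum {: I}) j.

Let sum_nthI (F : I -> \bar R) : \sum_(j < #|{: I}|) F (nthI j) = \sum_i F i.
Proof.
by rewrite -[RHS]big_enum (big_nth [tuple (ord0, ord0) | _ < M.+1]) big_mkord
  -cardE.
Qed.

Definition draw_kernel (z : S) : {measure set (S * I) -> \bar R} :=
  msum (fun j => mscale (NngNum (p0 z (nthI j))) (dirac (z, nthI j)))
    #|{: I}|.

Let draw_kernelE z A : draw_kernel z A = \sum_i (p z i)%:E * (\1_A (z, i))%:E.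
Proof.
rewrite -sum_nthI /= /msum; apply: eq_bigr => j _.
by [].
Qed.

Let measurable_draw_kernel A : measurable A ->
  measurable_fun setT (fun z => draw_kernel z A).
Proof.
move=> mA; under eq_fun do rewrite draw_kernelE.
apply: emeasurable_sum => i; apply: emeasurable_funM.
  exact/measurable_EFinP.
have mA1 : measurable_fun setT (\1_A : S * I -> R) by exact: measurable_indic.
by apply/measurable_EFinP/(measurableT_comp mA1 (g := fun z => (z, i)));
  exact: pair2_measurable.
Qed.

Lemma drawP : exists m : probability (S * I)%type R, draw mu p = m /\
  forall f : S * I -> \bar R, measurable_fun setT f -> (forall x, 0 <= f x) ->
  \int[m]_x f x = \int[mu]_z \sum_i (p z i)%:E * f (z, i).
Proof.
pose m0 := mixture_measure mu draw_kernel measurable_draw_kernel.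
have m01 : m0 setT = 1.
  rewrite /= /mixture -[RHS](integral_prob_cst mu); apply: eq_integral => z _.
  rewrite draw_kernelE; under eq_bigr do rewrite indicT mule1.
  by rewrite sumEFin p1.
have [m1 m1E] := measure_probabilityP m0 m01.
exists m1; rewrite -m1E; split=> [|f mf f0].
  apply/funext => A; rewrite /= /mixture /draw; apply: eq_integral => z _.
  by rewrite draw_kernelE.
rewrite (ge0_integral_mixture mu _ measurable_draw_kernel)//.
apply: eq_integral => z _.
rewrite ge0_integral_measure_sum// -sum_nthI; apply: eq_bigr => j _.
rewrite ge0_integral_mscale//= integral_dirac//.
by rewrite diracT mul1e.
Qed.

End draw.

(** * Marginals of independent draws *)

Section multinomial.
Context {R : realType} {J : finType} (n : nat) (w : J -> R).
Hypothesis w1 : (\sum_j w j = 1)%R.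

(** The constraint on coordinate [m] is absorbed into the [m]-th factor [F m]. The sum of products
    is then a product of sums, in which every other factor is 1. *)
Lemma sum_tuple_prod_marginal (m : 'I_n) j :
  (\sum_(s : n.-tuple J | tnth s m == j) \prod_(i < n) w (tnth s i) = w j)%R.
Proof.
pose F (i : 'I_n) x : R := if i == m then ((x == j)%:R * w x)%R else w x.
have FE (s : n.-tuple J) : (\prod_(i < n) F i (tnth s i) =
    (tnth s m == j)%:R * \prod_(i < n) w (tnth s i))%R.
  rewrite (bigD1 m)//= [in RHS](bigD1 m)//= /F eqxx mulrA; congr (_ * _)%R.
  by apply: eq_bigr => i /negbTE ->.
transitivity (\sum_(s : n.-tuple J) \prod_(i < n) F i (tnth s i))%R.
  rewrite big_mkcond; apply: eq_bigr => s _; rewrite FE.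
  by case: ifP; rewrite ?mul1r ?mul0r.
(* Tuples become finite functions, the index set of the distributivity law. *)
rewrite (reindex (fun f : {ffun 'I_n -> J} => [tuple f i | i < n])); last first.
  exists (fun s : n.-tuple J => [ffun i => tnth s i]) => x _.
    by apply/ffunP => i; rewrite ffunE tnth_mktuple.
  by apply: eq_from_tnth => i; rewrite tnth_mktuple ffunE.
under eq_bigr do under eq_bigr do rewrite tnth_mktuple.
rewrite -(bigA_distr_bigA F) (bigD1 m)//= [X in (_ * X)%R]big1 ?mulr1; last first.
  by move=> i /negbTE im; rewrite -[RHS]w1; apply: eq_bigr => x _; rewrite /F im.
rewrite (bigD1 j)//= /F !eqxx mul1r big1 ?addr0// => x /negbTE ->.
by rewrite mul0r.
Qed.

Lemma sum_tuple_prod : (\sum_(s : n.-tuple J) \prod_(i < n) w (tnth s i) = 1)%R.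
Proof.
case: n sum_tuple_prod_marginal => [_|m marg].
  by rewrite (bigD1 [tuple])//= big_ord0 big1 ?addr0// => s; rewrite tuple0.
rewrite (partition_big (fun s : m.+1.-tuple J => tnth s ord0) xpredT)//=.
by rewrite -[RHS]w1; apply: eq_bigr => j _; rewrite marg.
Qed.

Lemma esum_tuple_prod_marginal (m : 'I_n) (f : J -> \bar R) :
  (forall j, (0 <= w j)%R) ->
  \sum_(s : n.-tuple J) (\prod_(i < n) w (tnth s i))%:E * f (tnth s m) =
  \sum_j (w j)%:E * f j.
Proof.
move=> w0; rewrite (partition_big (fun s : n.-tuple J => tnth s m) xpredT)//=.
apply: eq_bigr => j _; rewrite -(sum_tuple_prod_marginal m) -sumEFin.
rewrite ge0_sume_distrl; last first.
  by move=> s _; rewrite lee_fin; exact: prodr_ge0.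
by apply: eq_bigr => s /eqP ->.
Qed.

End multinomial.

(** * Trajectories of resampled particles *)

Section dSMC_trajectories.
Context {d} {X : measurableType d} {M : nat}.
Local Notation N := M.+1.

Lemma resampled_Node c l r (z : vars (X := X) M (Node c l r)) n k :
  resampled M z n k = if (k < c)%N then resampled M z.1.1 (tnth z.2 n).1 k
                      else resampled M z.1.2 (tnth z.2 n).2 k.
Proof. by rewrite /resampled /=; case: ifP. Qed.

(** The index handed down to a child is random but takes finitely many values, so finite choice
    applies at each node. *)
Lemma measurable_resampled t n k :
  measurable_fun setT (fun z : vars (X := X) M t => resampled M z n k).
Proof.
elim: t n => [|c l ihl r ihr] n; first exact: measurable_tnth.
under eq_fun do rewrite resampled_Node.
have mpair : measurable_fun setT
    (fun z : vars (X := X) M (Node c l r) => tnth z.2 n).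
  exact: measurableT_comp (measurable_tnth n) measurable_snd.
case: (k < c)%N.
  apply: (measurable_fun_finite_choice
    (fun (z : vars (X := X) M (Node c l r)) i => resampled M z.1.1 i k)) => i.
    by apply: (measurableT_comp (ihl i)); exact: measurableT_comp.
  rewrite -[X in measurable X]setTI.
  exact: (measurableT_comp measurable_fst mpair).
apply: (measurable_fun_finite_choice
  (fun (z : vars (X := X) M (Node c l r)) i => resampled M z.1.2 i k)) => i.
  by apply: (measurableT_comp (ihr i)); exact: measurableT_comp.
rewrite -[X in measurable X]setTI.
exact: (measurableT_comp measurable_snd mpair).
Qed.

Definition trajectory (a b : nat) {t} (z : vars (X := X) M t) (n : 'I_N) : seq X :=
  [seq resampled M z n k | k <- index_iota a b.+1].

Lemma trajectory_Node a b c l r (z : vars (X := X) M (Node c l r)) n :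
  (a < c <= b)%N ->
  trajectory a b z n =
  trajectory a c.-1 z.1.1 (tnth z.2 n).1 ++ trajectory c b z.1.2 (tnth z.2 n).2.
Proof.
move=> /andP[ac cb]; have c0 : (0 < c)%N by exact: leq_ltn_trans ac.
rewrite /trajectory prednK// /index_iota.
have -> : (b.+1 - a = (c - a) + (b.+1 - c))%N.
  by rewrite addnC addnBA ?subnK// ltnW// ltnS.
rewrite iotaD subnKC ?(ltnW ac)// map_cat; congr (_ ++ _).
  apply/eq_in_map => k; rewrite mem_iota subnKC ?(ltnW ac)// => /andP[_ kc].
  by rewrite resampled_Node kc.
apply/eq_in_map => k; rewrite mem_iota => /andP[ck _].
by rewrite resampled_Node ltnNge ck.
Qed.

(** [trajectory] with its length in the type, as measurability requires; the length is left as the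
    size of the time list, which avoids casts. *)
Definition trajectory_tuple (a b : nat) {t} (z : vars (X := X) M t) (n : 'I_N) :
    (size (index_iota a b.+1)).-tuple X :=
  [tuple of map (resampled M z n) (in_tuple (index_iota a b.+1))].

Lemma measurable_trajectory_tuple a b t n :
  measurable_fun setT (fun z : vars (X := X) M t => trajectory_tuple a b z n).
Proof.
apply/measurable_fun_tnthP => i.
rewrite (_ : _ \o _ = fun z : vars M t =>
    resampled M z n (tnth (in_tuple (index_iota a b.+1)) i)).
  exact: measurable_resampled.
by apply/funext => p /=; rewrite tnth_map.
Qed.

Lemma measurable_trajectory a b t n {dZ} {Z : measurableType dZ} {R : realType}
    (F : Z -> seq X -> \bar R) : seq_measurable F ->
  measurable_fun [set: Z * vars (X := X) M t]
    (fun p => F p.1 (trajectory a b p.2 n)).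
Proof.
move=> mF; apply: (measurableT_comp (mF (size (index_iota a b.+1)))
  (g := fun p : Z * vars M t => (p.1, trajectory_tuple a b p.2 n))).
apply: measurable_fun_pair => //.
exact: (measurableT_comp (measurable_trajectory_tuple a b t n)).
Qed.

Lemma measurable_trajectory_cat a b a' b' l r n n' {dZ} {Z : measurableType dZ}
    {R : realType} (F : Z -> seq X -> \bar R) z : seq_measurable F ->
  measurable_fun [set: vars (X := X) M l * vars (X := X) M r]
    (fun v => F z (trajectory a b v.1 n ++ trajectory a' b' v.2 n')).
Proof.
move=> mF; have mG := seq_measurable_comp
  (fun (p : Z * _.-tuple X) s => F p.1 (p.2 ++ s))
  (fun v : vars M l => (z, trajectory_tuple a b v n))
  (seq_measurable_cat F _ mF).
apply: (measurable_trajectory a' b' r n' _ (mG _)).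
by apply: measurable_fun_pair => //; exact: measurable_trajectory_tuple.
Qed.

Lemma head_trajectory x0 a b t (z : vars (X := X) M t) n : (a <= b)%N ->
  head x0 (trajectory a b z n) = resampled M z n a.
Proof. by move=> ab; rewrite /trajectory /index_iota subSn. Qed.

Lemma last_trajectory x0 a b t (z : vars (X := X) M t) n : (a <= b)%N ->
  last x0 (trajectory a b z n) = resampled M z n b.
Proof.
move=> ab; rewrite /trajectory /index_iota subSn// -nth_last size_map size_iota.
by rewrite (nth_map 0%N) ?size_iota ?nth_iota ?subnKC.
Qed.

(** The star trajectory is what a root particle would follow had its resampled pair been (I, J), so
    [trajectory_Node] applies. *)
Lemma star_trajectoryE a b c l r
    (z : (vars (X := X) M l * vars (X := X) M r) * ('I_N * 'I_N)) :
  (a < c <= b)%N ->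
  star_trajectory M a b c l r z =
  trajectory a c.-1 z.1.1 z.2.1 ++ trajectory c b z.1.2 z.2.2 :> seq X.
Proof.
move=> acb; have /andP[ac cb] := acb.
(* All resampled pairs of [v] equal (I, J), and particle [ord0] is taken as representative. *)
pose v : vars (X := X) M (Node c l r) := (z.1, [tuple z.2 | _ < N]).
have := trajectory_Node a b c l r v ord0 acb.
rewrite {2 3}/v/= tnth_mktuple => <-.
rewrite /trajectory /index_iota subSn ?(leq_trans (ltnW ac))//.
rewrite -[a in iota a _]addn0 iotaDl -val_enum_ord -!map_comp.
apply: eq_map => i /=; rewrite resampled_Node /= tnth_mktuple /sigma_star.
by case: ifP.
Qed.

End dSMC_trajectories.

(** * Unbiasedness along the tree *)

Lemma tree_on_leq a b t : tree_on a b t -> (a <= b)%N.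
Proof.
case: t => [/eqP ->//|c l r /= /and3P[/andP[ac cb] _ _]].
by rewrite (leq_trans (ltnW ac)).
Qed.

Lemma esum_average {R : realType} n (C : \bar R) :
  \sum_(i < n.+1) (n.+1%:R^-1)%:E * C = C.
Proof.
rewrite -ge0_sume_distrl; last by move=> i _; rewrite lee_fin invr_ge0.
by rewrite sumEFin sumr_const card_ord -[X in X%:E]mulr_natr mulVf ?mul1e// pnatr_eq0.
Qed.

Section dSMC_law.
Context {d} {X : measurableType d} {R : realType} (M T : nat).
Local Notation N := M.+1.
Variables (nu q : nat -> probability X R) (g : nat -> X -> R).
Variable omega : nat -> X * X -> R.
Hypothesis mg : forall t, (t <= T)%N -> measurable_fun setT (g t).
Hypothesis g0 : forall t x, (t <= T)%N -> (0 <= g t x)%R.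
Hypothesis gE : forall t A, (t <= T)%N -> measurable A ->
  nu t A = \int[q t]_(x in A) (g t x)%:E.
Hypothesis momega : forall t, (0 < t <= T)%N -> measurable_fun setT (omega t).
Hypothesis omega0 : forall t p, (0 < t <= T)%N -> (0 <= omega t p)%R.

Local Notation vars := (vars (X := X) M).
Local Notation LN := (LN M g omega).
Local Notation LN_children := (LN_children M g omega).
Local Notation node_weight := (node_weight M g).
Local Notation pair_weight := (pair_weight M g omega).
Local Notation W := (W M g omega).
Local Notation psi := (psi M q g omega).

Lemma node_weight_ge0 a t (z : vars t) n : (a <= T)%N -> (0 <= node_weight a z n)%R.
Proof.
move=> aT; case: t z => [z|c l r z] /=; last by rewrite invr_ge0.
by apply: normalize_ge0 => j; exact: g0.
Qed.

Lemma measurable_node_weight a t n : (a <= T)%N ->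
  measurable_fun setT (fun z : vars t => node_weight a z n).
Proof.
move=> aT; case: t => [|c l r]; last exact: measurable_cst.
apply: (measurable_normalize (fun z i => g a (tnth z i))) => [z j|j].
  exact: g0.
exact: measurableT_comp (mg a aT) (measurable_tnth j).
Qed.

Lemma pair_weight_ge0 a c l r (z : vars l * vars r) p :
  (a < c <= T)%N -> (0 <= pair_weight a c z p)%R.
Proof.
move=> /andP[ac cT]; have aT := leq_trans (ltnW ac) cT.
rewrite /pair_weight !mulr_ge0// ?node_weight_ge0//.
by rewrite omega0// (leq_ltn_trans _ ac).
Qed.

Lemma measurable_pair_weight a c l r p : (a < c <= T)%N ->
  measurable_fun setT (fun z : vars l * vars r => pair_weight a c z p).
Proof.
move=> /andP[ac cT]; have aT := leq_trans (ltnW ac) cT.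
apply: measurable_funM.
  apply: measurable_funM.
    exact: (measurableT_comp (measurable_node_weight a l p.1 aT) measurable_fst).
  exact: (measurableT_comp (measurable_node_weight c r p.2 cT) measurable_snd).
apply: measurableT_comp; first by apply: momega; rewrite cT (leq_ltn_trans _ ac).
apply: measurable_fun_pair.
  exact: (measurableT_comp (measurable_resampled l p.1 c.-1) measurable_fst).
exact: (measurableT_comp (measurable_resampled r p.2 c) measurable_snd).
Qed.

Lemma W_ge0 a c l r (z : vars l * vars r) p : (a < c <= T)%N -> (0 <= W a c z p)%R.
Proof. by move=> acT; apply: normalize_ge0 => j; exact: pair_weight_ge0. Qed.

Lemma sum_W a c l r (z : vars l * vars r) : (\sum_p W a c z p = 1)%R.
Proof. by apply: sum_normalize; rewrite card_prod card_ord. Qed.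

Lemma measurable_W a c l r p : (a < c <= T)%N ->
  measurable_fun setT (fun z : vars l * vars r => W a c z p).
Proof.
move=> acT; apply: measurable_normalize => [z j|j].
  exact: pair_weight_ge0.
exact: measurable_pair_weight.
Qed.

Let tree_on_Node a b c l r : tree_on a b (Node c l r) -> (b <= T)%N ->
  [/\ (a < c <= T)%N, (c.-1 <= T)%N, tree_on a c.-1 l & tree_on c b r].
Proof.
move=> /= /and3P[/andP[ac cb] tl tr] bT; have cT := leq_trans cb bT.
by split=> //; [rewrite ac | exact: leq_trans (leq_pred c) cT].
Qed.

Lemma LN_ge0 a b t (z : vars t) : tree_on a b t -> (b <= T)%N -> (0 <= LN a z)%R.
Proof.
elim: t a b z => [|c l ihl r ihr] a b z tab bT.
  rewrite /= mulr_ge0// ?invr_ge0// sumr_ge0// => n _.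
  by apply: g0; exact: leq_trans (tree_on_leq _ _ _ tab) bT.
have [acT c1T tl tr] := tree_on_Node _ _ _ _ _ tab bT.
rewrite /= !mulr_ge0 ?(ihl a c.-1) ?(ihr c b)//.
by do 2 (apply: sumr_ge0 => ? _); exact: pair_weight_ge0.
Qed.

Lemma measurable_LN_children a b c l r :
  tree_on a b (Node c l r) -> (b <= T)%N ->
  measurable_fun setT (fun z : vars l => LN a z) ->
  measurable_fun setT (fun z : vars r => LN c z) ->
  measurable_fun setT (fun z : vars l * vars r => LN_children a c z).
Proof.
move=> tab bT ml mr; have [acT c1T tl tr] := tree_on_Node _ _ _ _ _ tab bT.
apply: measurable_funM.
  apply: measurable_funM.
    exact: (measurableT_comp ml measurable_fst).
  exact: (measurableT_comp mr measurable_snd).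
by apply: measurable_sum => i; apply: measurable_sum => j;
  exact: measurable_pair_weight.
Qed.

Lemma measurable_LN a b t : tree_on a b t -> (b <= T)%N ->
  measurable_fun setT (fun z : vars t => LN a z).
Proof.
elim: t a b => [|c l ihl r ihr] a b tab bT.
  apply: measurable_funM => //; apply: measurable_sum => n.
  apply: measurableT_comp (measurable_tnth n); apply: mg.
  exact: leq_trans (tree_on_leq _ _ _ tab) bT.
have [acT c1T tl tr] := tree_on_Node _ _ _ _ _ tab bT.
have := measurable_LN_children _ _ _ _ _ tab bT (ihl _ _ tl c1T) (ihr _ _ tr bT).
by move=> mLN; exact: (measurableT_comp mLN measurable_fst).
Qed.

Lemma psi_NodeP a b c l r (ml : probability (vars l) R) (mr : probability (vars r) R) :
  tree_on a b (Node c l r) -> (b <= T)%N -> psi a l = ml -> psi c r = mr ->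
  exists m : probability (vars (Node c l r)) R, psi a (Node c l r) = m /\
  forall f : vars (Node c l r) -> \bar R,
    measurable_fun setT f -> (forall z, 0 <= f z) ->
    \int[m]_z f z = \int[ml \x mr]_z \sum_(s : N.-tuple ('I_N * 'I_N))
      (\prod_(n < N) W a c z (tnth s n))%:E * f (z, s).
Proof.
move=> tab bT mlE mrE; have [acT c1T tl tr] := tree_on_Node _ _ _ _ _ tab bT.
pose p (z : vars l * vars r) (s : N.-tuple ('I_N * 'I_N)) :=
  (\prod_(n < N) W a c z (tnth s n))%R.
have p0 (z : vars l * vars r) s : (0 <= p z s)%R.
  by apply: prodr_ge0 => n _; exact: W_ge0.
have mp s : measurable_fun setT (fun z : vars l * vars r => p z s).
  by apply: measurable_prod => n _; exact: measurable_W.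
have p1 (z : vars l * vars r) : (\sum_s p z s = 1)%R.
  by apply: sum_tuple_prod; exact: sum_W.
have [m [mE mI]] := drawP M (ml \x mr)%E p p0 mp p1.
by exists m; rewrite /= mlE mrE.
Qed.

Lemma psiP a b t : tree_on a b t -> (b <= T)%N ->
  exists m : probability (vars t) R, psi a t = m.
Proof.
elim: t a b => [|c l ihl r ihr] a b tab bT.
  by have [m [mE _]] := product_powerP (q a) N; exists m.
have [acT c1T tl tr] := tree_on_Node _ _ _ _ _ tab bT.
have [ml mlE] := ihl _ _ tl c1T; have [mr mrE] := ihr _ _ tr bT.
by have [m [mE _]] := psi_NodeP _ _ _ _ _ ml mr tab bT mlE mrE; exists m.
Qed.

Local Notation path_law_integral := (path_law_integral nu omega).

(** The invariant of the tree induction. Quantifying over [Z] lets the hypothesis at one child be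
    used with a test function that depends on the trajectory of the other. *)
Let unbiased_on a b t := forall dZ (Z : measurableType dZ)
    (F : Z -> seq X -> \bar R) z,
  seq_measurable F -> (forall z s, 0 <= F z s) ->
  \int[psi a t]_v \sum_(n < N) (LN a v * node_weight a v n)%:E *
      F z (trajectory a b v n)
  = path_law_integral a b (F z).

Let measurable_summand a b t n {dZ} {Z : measurableType dZ}
    (F : Z -> seq X -> \bar R) :
  tree_on a b t -> (b <= T)%N -> seq_measurable F ->
  measurable_fun [set: Z * vars t]
    (fun p => (LN a p.2 * node_weight a p.2 n)%:E * F p.1 (trajectory a b p.2 n)).
Proof.
move=> tab bT mF; have aT := leq_trans (tree_on_leq _ _ _ tab) bT.
apply: emeasurable_funM; last exact: measurable_trajectory.
apply/measurable_EFinP; apply: measurable_funM.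
  exact: (measurableT_comp (measurable_LN a b t tab bT) measurable_snd).
exact: (measurableT_comp (measurable_node_weight a t n aT) measurable_snd).
Qed.

(** The last factor of the estimate is the normalizing sum of [W], so [normalizeM] cancels it. *)
Lemma LN_childrenW a b c l r (z : vars l * vars r) p :
  tree_on a b (Node c l r) -> (b <= T)%N ->
  (LN_children a c z * W a c z p =
   (LN a z.1 * node_weight a z.1 p.1) * ((LN c z.2 * node_weight c z.2 p.2) *
     omega c (resampled M z.1 p.1 c.-1, resampled M z.2 p.2 c)))%R.
Proof.
move=> tab bT; have [acT _ _ _] := tree_on_Node _ _ _ _ _ tab bT.
rewrite /Defs.LN_children pair_big/= -mulrA.
rewrite (eq_bigr (pair_weight a c z)); last by case.
rewrite normalizeM; last by move=> j; exact: pair_weight_ge0.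
by rewrite /Defs.pair_weight; ring.
Qed.


Section children.
Variables (x0 : X) (a b c : nat) (l r : split_tree).
Hypotheses (tab : tree_on a b (Node c l r)) (bT : (b <= T)%N).
Context {dZ} {Z : measurableType dZ} (F : Z -> seq X -> \bar R) (z : Z).
Hypotheses (mF : seq_measurable F) (F0 : forall z s, 0 <= F z s).

Let pairF (v : vars l * vars r) (p : 'I_N * 'I_N) : \bar R :=
  (LN_children a c v * W a c v p)%:E *
  F z (trajectory a c.-1 v.1 p.1 ++ trajectory c b v.2 p.2).

Lemma measurable_pairF p : measurable_fun setT (pairF ^~ p).
Proof.
have [acT c1T tl tr] := tree_on_Node _ _ _ _ _ tab bT.
apply: emeasurable_funM; last exact: measurable_trajectory_cat.
apply/measurable_EFinP; apply: measurable_funM; last exact: measurable_W.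
by apply: (measurable_LN_children a b) => //;
  [exact: measurable_LN tl _|exact: measurable_LN tr _].
Qed.

Lemma pairF_ge0 v p : 0 <= pairF v p.
Proof.
have [acT c1T tl tr] := tree_on_Node _ _ _ _ _ tab bT.
rewrite mule_ge0// lee_fin mulr_ge0 ?W_ge0// !mulr_ge0//.
- exact: LN_ge0 tl _.
- exact: LN_ge0 tr _.
- by do 2 (apply: sumr_ge0 => ? _); exact: pair_weight_ge0.
Qed.

(** The right-hand side is unfolded: cut at [c], replace gamma_{a:c-1} by its estimate through the
    left child, then gamma_{c:b} through the right child with the left trajectory frozen. Tonelli on
    the product law gives the same iterated integral on the left-hand side. *)
Lemma integral_children : unbiased_on a c.-1 l -> unbiased_on c b r ->
  \int[psi a l \x psi c r]_v (\sum_p (LN_children a c v * W a c v p)%:E *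
     F z (trajectory a c.-1 v.1 p.1 ++ trajectory c b v.2 p.2)) =
  path_law_integral a b (F z).
Proof.
move=> ihl ihr; have [acT c1T tl tr] := tree_on_Node _ _ _ _ _ tab bT.
have /and3P[/andP[ac cb] _ _] : [&& (a < c <= b)%N, _ & _] := tab.
have c0 : (0 < c)%N by exact: leq_ltn_trans ac.
have ac1 : (a <= c.-1)%N by rewrite -ltnS prednK.
have [ml mlE] := psiP _ _ _ tl c1T; have [mr mrE] := psiP _ _ _ tr bT.
have cT : (0 < c <= T)%N by rewrite c0 (leq_trans cb).
rewrite (path_law_integral_cat _ _ T momega omega0 a b c F z x0) ?ac//.
have mH : seq_measurable (fun z u => path_law_integral c b (fun v =>
    (omega c (last x0 u, head x0 v))%:E * F z (u ++ v))).
  by apply: (seq_measurable_path_law_integral _ _ T) => //; rewrite c0.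
rewrite -(ihl _ _ _ z mH); last first.
  move=> z' u; apply: (path_law_integral_ge0 _ _ T) => //; first by rewrite cb.
  by move=> s; rewrite mule_ge0// lee_fin omega0.
rewrite mlE mrE (fubini_tonelli1 (fun v => \sum_p pairF v p)); last 2 first.
- by apply: emeasurable_sum => p; exact: measurable_pairF.
- by move=> v; apply: sume_ge0 => p _; exact: pairF_ge0.
apply: eq_integral => v1 _; rewrite /fubini_F.
(* The test function for the right child: its parameter holds the left trajectory, and it contains
   the weight across the cut. *)
pose F' m (p : Z * m.-tuple X) v :=
  (omega c (last x0 p.2, head x0 v))%:E * F p.1 (p.2 ++ v).
have mF' m : seq_measurable (F' m) by exact: (seq_measurable_omegaM _ T).
have F0' m p v : 0 <= F' m p v by rewrite mule_ge0// lee_fin omega0.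
under eq_bigr => i _.
  rewrite -(ihr _ _ (F' _) (z, trajectory_tuple a c.-1 v1 i) (mF' _) (F0' _)) mrE.
  over.
pose A i := (LN a v1 * node_weight a v1 i)%R.
have A0 i : (0 <= A i)%R.
  rewrite mulr_ge0 ?node_weight_ge0//; first exact: LN_ge0 tl _.
  by case/andP: acT => /ltnW; exact: leq_trans.
pose B i j (v : vars r) := (LN c v * node_weight c v j)%:E *
  F' _ (z, trajectory_tuple a c.-1 v1 i) (trajectory c b v j).
have B0 i j v : 0 <= B i j v.
  rewrite mule_ge0// lee_fin mulr_ge0//; first exact: LN_ge0 tr _.
  by rewrite node_weight_ge0//; case/andP: cT.
have mB i j : measurable_fun setT (B i j).
  apply: (measurableT_comp (measurable_summand c b r j (F' _) tr bT (mF' _))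
    (g := pair (z, trajectory_tuple a c.-1 v1 i))).
  exact: pair1_measurable.
transitivity (\sum_i (A i)%:E * \int[mr]_v \sum_j B i j v); last by [].
under [RHS]eq_bigr => i _.
  rewrite -ge0_integralZl//; last 3 first.
  - by apply: emeasurable_sum => j; exact: mB.
  - by move=> v _; apply: sume_ge0 => j _; exact: B0.
  - by rewrite lee_fin.
  over.
rewrite -ge0_integral_sum//; last 2 first.
- move=> i; apply: measurable_funeM; apply: emeasurable_sum => j; exact: mB.
- by move=> i v _; rewrite mule_ge0// ?lee_fin//; apply: sume_ge0 => j _; exact: B0.
apply: eq_integral => v2 _.
under [RHS]eq_bigr do rewrite ge0_sume_distrr//.
rewrite pair_big; apply: eq_bigr => -[i j] _; rewrite /pairF.
rewrite (LN_childrenW a b)// /A /B /F'/=.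
(* The end states of the two trajectories are the particles at times c-1 and c that enter [omega c]
   in the pair weight. *)
by rewrite (last_trajectory x0 a c.-1 l v1 i ac1) head_trajectory// !EFinM !muleA.
Qed.

End children.

(** Each of the [N] resampled pairs has marginal law [W], so all [N] terms have the same conditional
    mean given the children. With weights 1/N they average to the integrand of
    [integral_children]. *)
Lemma psi_Node_unbiased (x0 : X) a b c l r : tree_on a b (Node c l r) -> (b <= T)%N ->
  unbiased_on a c.-1 l -> unbiased_on c b r -> unbiased_on a b (Node c l r).
Proof.
move=> tab bT ihl ihr dZ Z F z mF F0.
have [acT c1T tl tr] := tree_on_Node _ _ _ _ _ tab bT.
have /and3P[/andP[ac cb] _ _] : [&& (a < c <= b)%N, _ & _] := tab.
have [ml mlE] := psiP _ _ _ tl c1T; have [mr mrE] := psiP _ _ _ tr bT.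
have [m [mE mI]] := psi_NodeP _ _ _ _ _ ml mr tab bT mlE mrE.
rewrite mE mI; last 2 first.
- apply: emeasurable_sum => n.
  apply: (measurableT_comp
    (measurable_summand a b (Node c l r) n F tab bT mF) (g := pair z)).
  exact: (pair1_measurable z).
- move=> v; apply: sume_ge0 => n _; rewrite mule_ge0// lee_fin mulr_ge0//.
    exact: LN_ge0 tab bT.
  by apply: node_weight_ge0; exact: leq_trans (tree_on_leq _ _ _ tab) bT.
rewrite -(integral_children x0 a b c l r tab bT F z mF F0 ihl ihr) mlE mrE.
apply: eq_integral => v _.
pose f p := (LN_children a c v * N%:R^-1)%:E *
  F z (trajectory a c.-1 v.1 p.1 ++ trajectory c b v.2 p.2).
have L0 : (0 <= LN_children a c v)%R.
  rewrite !mulr_ge0//; [exact: LN_ge0 tl _|exact: LN_ge0 tr _|].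
  by do 2 (apply: sumr_ge0 => ? _); exact: pair_weight_ge0.
have f0 p : 0 <= f p by rewrite mule_ge0// lee_fin mulr_ge0// invr_ge0.
(* The probability of [s] is distributed over the particles, so that the two sums can be exchanged
   and only one coordinate of [s] remains. *)
transitivity (\sum_(s : N.-tuple ('I_N * 'I_N)) \sum_(n < N)
    (\prod_(n < N) W a c v (tnth s n))%:E * f (tnth s n)).
  apply: eq_bigr => s _; rewrite ge0_sume_distrr; last first.
    by move=> n _; rewrite mule_ge0// lee_fin mulr_ge0//= invr_ge0.
  by apply: eq_bigr => n _; rewrite trajectory_Node ?ac.
rewrite exchange_big/=.
have W0 p : (0 <= W a c v p)%R by exact: W_ge0.
under eq_bigr => n _ do
  rewrite (esum_tuple_prod_marginal _ (W a c v) (sum_W a c l r v) n f W0).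
under eq_bigr => n _.
  rewrite (_ : \sum_p _ = (N%:R^-1)%:E * \sum_p (LN_children a c v * W a c v p)%:E *
      F z (trajectory a c.-1 v.1 p.1 ++ trajectory c b v.2 p.2)); last first.
    rewrite ge0_sume_distrr; last first.
      by move=> p _; rewrite mule_ge0// lee_fin mulr_ge0// W_ge0.
    apply: eq_bigr => p _; rewrite /f !muleA -!EFinM; congr (_%:E * _).
    by ring.
  over.
exact: esum_average.
Qed.

Lemma psi_unbiased (x0 : X) a b t : tree_on a b t -> (b <= T)%N -> unbiased_on a b t.
Proof.
elim: t a b => [|c l ihl r ihr] a b tab bT dZ Z F z mF F0.
  have /eqP ab : a == b by [].
  move: bT; rewrite -ab => aT.
  have [m [mE mI]] := product_powerP (q a) N.
  have mF1 : measurable_fun setT (fun x : X => F z [:: x]).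
    apply: (measurableT_comp (mF 1%N) (g := fun x : X => (z, [tuple x]))).
    apply: measurable_fun_pair => //; exact: measurable_cons.
  have mgF : measurable_fun setT (fun x : X => (g a x)%:E * F z [:: x]).
    by apply: emeasurable_funM => //; apply/measurable_EFinP; exact: mg.
  have gF0 x : 0 <= (g a x)%:E * F z [:: x] by rewrite mule_ge0// lee_fin g0.
  have -> : psi a Leaf = m by exact: mE.
  transitivity (\int[m]_v \sum_(n < N)
      (N%:R^-1)%:E * ((g a (tnth v n))%:E * F z [:: tnth v n])).
    apply: eq_integral => v _; apply: eq_bigr => n _; rewrite /= muleA -EFinM.
    (* The sum in the estimate cancels the normalization, leaving g/N for each particle. *)
    rewrite -mulrA normalizeM; last by move=> j; exact: g0.
    by rewrite /trajectory /index_iota subSnn.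
  rewrite ge0_integral_sum//; last 2 first.
  - move=> n; apply: measurable_funeM.
    exact: (measurableT_comp mgF (measurable_tnth n)).
  - by move=> n v _; rewrite mule_ge0// lee_fin invr_ge0.
  under eq_bigr => n _.
    rewrite ge0_integralZl//; last first.
      exact: (measurableT_comp mgF (measurable_tnth n)).
    rewrite (mI (fun x => (g a x)%:E * F z [:: x]))//.
    over.
  rewrite esum_average /path_law_integral subnn /=.
  (* Importance sampling: [g a] is the density of [nu a] with respect to [q a]. *)
  rewrite -ge0_integral_density//; [|exact: mg|by move=> x; exact: g0].
  have [k kE] := density_measureP (q a) (g a) (mg a aT) (g0 a ^~ aT).
  rewrite kE; apply: eq_measure_integral => A mA _.
  by rewrite -kE gE.
have [acT c1T tl tr] := tree_on_Node _ _ _ _ _ tab bT.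
by apply: psi_Node_unbiased => //; [exact: ihl|exact: ihr].
Qed.

(** The density of [pi_law] times [W] is the integrand of [integral_children] divided by the
    normalizing constant, which comes out of the integral. *)
Lemma integral_pi_law (P : nat -> R.-pker X ~> X) (h : nat -> X -> R) (x0 : X)
    a b c l r {dZ} {Z : measurableType dZ} (F : Z -> seq X -> \bar R) z :
  tree_on a b (Node c l r) -> (b <= T)%N ->
  0 <= normalizing_constant P h nu a b ->
  seq_measurable F -> (forall z s, 0 <= F z s) ->
  \int[pi_law M q g omega P h nu a b c l r]_v (\sum_p (W a c v p)%:E *
    F z (trajectory a c.-1 v.1 p.1 ++ trajectory c b v.2 p.2)) =
  ((fine (normalizing_constant P h nu a b))^-1)%:E * path_law_integral a b (F z).
Proof.
move=> tab bT L0 mF F0; set L := fine _; have {}L0 : (0 <= L)%R by exact: fine_ge0.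
have [acT c1T tl tr] := tree_on_Node _ _ _ _ _ tab bT.
have [ml mlE] := psiP _ _ _ tl c1T; have [mr mrE] := psiP _ _ _ tr bT.
have C0 (v : vars l * vars r) : (0 <= LN_children a c v)%R.
  rewrite !mulr_ge0//; [exact: LN_ge0 tl _|exact: LN_ge0 tr _|].
  by do 2 (apply: sumr_ge0 => ? _); exact: pair_weight_ge0.
have mC : measurable_fun setT (fun v : vars l * vars r => LN_children a c v).
  by apply: (measurable_LN_children a b) => //;
    [exact: measurable_LN tl _|exact: measurable_LN tr _].
rewrite /pi_law -/L mlE mrE.
rewrite (ge0_integral_density (ml \x mr)%E (fun v => LN_children a c v / L)%R).
- rewrite -(integral_children x0 a b c l r tab bT F z mF F0); last 2 first.
  + exact: psi_unbiased.
  + exact: psi_unbiased.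
  rewrite mlE mrE -ge0_integralZl//; last 3 first.
  + by apply: emeasurable_sum => p; exact: measurable_pairF.
  + by move=> v _; apply: sume_ge0 => p _; exact: pairF_ge0.
  + by rewrite lee_fin invr_ge0.
  apply: eq_integral => v _.
  rewrite !ge0_sume_distrr; last 2 first.
  + by move=> p _; exact: pairF_ge0.
  + by move=> p _; rewrite mule_ge0// lee_fin W_ge0.
  apply: eq_bigr => p _; rewrite !muleA -!EFinM; congr (_%:E * _).
  by ring.
- exact: measurable_funM.
- by move=> v; rewrite divr_ge0.
- apply: emeasurable_sum => p.
  apply: emeasurable_funM; last exact: measurable_trajectory_cat.
  by apply/measurable_EFinP; exact: measurable_W.
- by move=> v; apply: sume_ge0 => p _; rewrite mule_ge0// lee_fin W_ge0.
Qed.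

End dSMC_law.

(** * Indicators of sets of paths and the law of the star trajectory *)

Lemma indic_image_val {T : Type} {R : realType} n (A : set (n.-tuple T))
    (v : n.-tuple T) :
  \1_((fun v : n.-tuple T => val v) @` A) (val v) = \1_A v :> R.
Proof.
rewrite !indicE; congr ((_ : bool)%:R)%R; apply/idP/idP; rewrite !inE.
  by case=> u Au /val_inj <-.
by exists v.
Qed.

(** The indicator of [A] becomes a test function on sequences through the image of [A] under [val]:
    it is the indicator of [A] at length [n] and 0 at every other length. *)
Lemma seq_measurable_indic {d} {X : measurableType d} {R : realType} n
    (A : set (n.-tuple X)) {dZ} {Z : measurableType dZ} : measurable A ->
  seq_measurable (fun (_ : Z) s => (\1_((fun v : n.-tuple X => val v) @` A) s : R)%:E).
Proof.
move=> mA m; apply/measurable_EFinP.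
have [nm|/eqP nm] := eqVneq n m.
  case: m / nm.
  rewrite (_ : (fun p => _) = (fun p : Z * n.-tuple X => \1_A p.2 : R)).
    have mA1 : measurable_fun setT (\1_A : n.-tuple X -> R).
      exact: measurable_indic.
    exact: (measurableT_comp mA1 measurable_snd).
  by apply/funext => -[z v]; exact: indic_image_val.
rewrite (_ : (fun p => _) = cst 0%R); first exact: measurable_cst.
apply/funext => -[z v] /=; rewrite indicE memNset// => -[u _ uv].
by apply: nm; rewrite -(size_tuple u) -(size_tuple v) -uv.
Qed.

Theorem proposition3p1 (d : measure_display) (X : measurableType d)
    (R : realType) (T : nat) (P : nat -> R.-pker X ~> X) (h : nat -> X -> R)
    (nu q : nat -> probability X R) (g : nat -> X -> R)
    (omega : nat -> X * X -> R) (M a b c : nat) (l r : split_tree) :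
  (0 < T)%N ->
  (forall t, (0 < t <= T)%N ->
     measurable_fun [set: X] (h t) /\ (forall x, (0 <= h t x)%R)) ->
  (forall t x, (0 < t <= T)%N -> P t x `<< nu t) ->
  (forall s t, (s <= t <= T)%N ->
     0 < normalizing_constant P h nu s t < +oo) ->
  (forall t, (0 < t <= T)%N ->
     measurable_fun [set: X * X] (omega t) /\
     forall x, is_RN_derivative (nu t)
       (fun A => \int[P t x]_(y in A) (h t y)%:E) (fun y => omega t (x, y))) ->
  (forall t, (t <= T)%N -> nu t `<< q t) ->
  (forall t, (t <= T)%N -> is_RN_derivative (q t) (nu t) (g t)) ->
  (a < b <= T)%N ->
  tree_on a b (Node c l r) ->
  forall A : set ((b - a).+1.-tuple X), measurable A ->
    pushforward (star_law M q g omega P h nu a b c l r)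
                (star_trajectory M a b c l r) A
    = Q P h nu a b A.
Proof.
move=> T0 Hh Hac HL Homega Hnu Hg /andP[ab bT] tab A mA.
have momega t : (0 < t <= T)%N -> measurable_fun setT (omega t).
  by move=> tT; have [] := Homega t tT.
have omega0 t p : (0 < t <= T)%N -> (0 <= omega t p)%R.
  by case: p => x y tT; have [_ /(_ x)[_ w0 _]] := Homega t tT; exact: w0.
have omegaE t x B : (0 < t <= T)%N -> measurable B ->
    \int[P t x]_(y in B) (h t y)%:E = \int[nu t]_(y in B) (omega t (x, y))%:E.
  by move=> tT mB; have [_ /(_ x)[_ _ wE]] := Homega t tT; exact: wE.
have mg t : (t <= T)%N -> measurable_fun setT (g t) by move=> /Hg[].
have g0 t x : (t <= T)%N -> (0 <= g t x)%R by move=> /Hg[_ + _]; exact.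
have gE t B : (t <= T)%N -> measurable B -> nu t B = \int[q t]_(x in B) (g t x)%:E.
  by move=> /Hg[_ _ +]; exact.
(* A space carrying a probability is nonempty; [x0] supplies the default state for [head] and
   [last]. *)
have [x0 _] : exists x : X, True.
  apply: contrapT => X0; have := probability_setT (nu 0%N).
  rewrite (_ : [set: X] = set0) ?measure0; last first.
    by apply/seteqP; split => // x _; apply: X0; exists x.
  by move/eqP; rewrite eq_sym onee_eq0.
have /and3P[acb _ _] : [&& (a < c <= b)%N, _ & _] := tab.
pose F (_ : unit) (s : seq X) : \bar R :=
  (\1_((fun v : (b - a).+1.-tuple X => val v) @` A) s : R)%:E.
have mF : seq_measurable F by exact: seq_measurable_indic.
have F0 z s : 0 <= F z s by rewrite lee_fin indicE.
have FE z v : F z (val v) = (\1_A v)%:E by rewrite /F indic_image_val.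
have L0 : 0 <= normalizing_constant P h nu a b.
  by apply/ltW; have /andP[] := HL a b (introT andP (conj (ltnW ab) bT)).
(* Both laws of [A] equal gamma_{a:b} of its indicator divided by L_{a:b}: first the star law, then
   [Q]. *)
transitivity (((fine (normalizing_constant P h nu a b))^-1)%:E *
    path_law_integral nu omega a b (F tt)).
  rewrite -(integral_pi_law M T nu q g omega mg g0 gE momega omega0 P h x0 a b c l r
    F tt tab bT L0 mF F0).
  rewrite /pushforward /star_law /draw; congr (integral _ _ _).
  apply/funext => v; apply: eq_bigr => p _; congr (_ * _).
  by rewrite -(star_trajectoryE a b c l r (v, p) acb) FE.
rewrite /Q; congr (_ * _).
rewrite -(integral_path_law nu omega T momega omega0 P h _ _ omegaE _ _ F tt)
  ?(ltnW ab)//.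
- have [m ->] := path_law_measureP P nu a b.
  rewrite [RHS]integral_mkcond; apply: eq_integral => v _.
  by rewrite patchE FE indicE; case: ifP; rewrite ?mule1 ?mule0.
- by move=> t /Hh[].
- by move=> t x /Hh[_ +]; exact.
Qed.
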